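(* Let $\Omega\subset\mathbb{R}^d$ be an open neighbourhood of $\mathbf{0}$, $k\ge1$, and $K\in\mathcal{C}^{(k+1,k+1)}(\Omega\times\Omega)$. Let $\mathbf{x}_1,\ldots,\mathbf{x}_n\in\mathbb{R}^d$ with $\#\mathbb{P}_{k-1}<n\le\#\mathbb{P}_k$, and $\mathbf{K}_\varepsilon=[K(\varepsilon\mathbf{x}_i,\varepsilon\mathbf{x}_j)]_{i,j=1}^n$. Then as $\varepsilon\to0$: 1. If $n=\#\mathbb{P}_k$, then $\det\mathbf{K}_\varepsilon=\varepsilon^{2M(k,d)}\big(\det\mathbf{W}_k\,(\det\mathbf{V}_{\le k})^2+\mathcal{O}(\varepsilon)\big)$. 2. If $n<\#\mathbb{P}_k$ and $\ell=\#\mathbb{P}_k-n$, then \[\det\mathbf{K}_\varepsilon=\varepsilon^{2(M(k,d)-k\ell)}\big(\det(\mathbf{Y}\mathbf{W}_k\mathbf{Y}^\top)\det(\mathbf{V}_{\le k-1}^\top\mathbf{V}_{\le k-1})+\mathcal{O}(\varepsilon)\big),\] where $\mathbf{Y}=\begin{bmatrix}\mathbf{I}_{\#\mathbb{P}_{k-1}} & \\ & \mathbf{Q}_\perp^\top\mathbf{V}_k\end{bmatrix}\in\mathbb{R}^{n\times\#\mathbb{P}_k}$ and $\mathbf{Q}_\perp\in\mathbb{R}^{n\times(n-\#\mathbb{P}_{k-1})}$ consists of the last $n-\#\mathbb{P}_{k-1}$ columns of the orthogonal factor $\mathbf{Q}_{\rm full}\in\mathbb{R}^{n\times n}$ of a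 full QR factorization of $\mathbf{V}_{\le k-1}$. 3. If for some $\varepsilon_0>0$, $\mathbf{K}_\varepsilon$ is positive semidefinite for $\varepsilon\in[0,\varepsilon_0]$, then its eigenvalues, listed in nonincreasing order, split into $k+1$ consecutive groups: one eigenvalue that is $\mathcal{O}(1)$, then $\#\mathbb{H}_1=d$ eigenvalues that are $\mathcal{O}(\varepsilon^2)$, …, then $\#\mathbb{H}_s$ eigenvalues that are $\mathcal{O}(\varepsilon^{2s})$ for each $s<k$, and finally $\#\mathbb{H}_k-\ell$ eigenvalues that are $\mathcal{O}(\varepsilon^{2k})$ (with $\ell=\#\mathbb{P}_k-n$).
   Context: Multi-indices $\boldsymbol\alpha\in\mathbb{Z}_+^d$: $|\boldsymbol\alpha|=\sum_i\alpha_i$, $\boldsymbol\alpha!=\prod_i\alpha_i!$, $\mathbf{x}^{\boldsymbol\alpha}=\prod_i x_i^{\alpha_i}$. $\mathbb{P}_k=\{\boldsymbol\alpha:|\boldsymbol\alpha|\le k\}$, $\mathbb{H}_k=\{\boldsymbol\alpha:|\boldsymbol\alpha|=k\}$, so $\#\mathbb{P}_k=\binom{k+d}{d}$, $\#\mathbb{H}_k=\binom{k+d-1}{d-1}$. A fixed graded total order on multi-indices is used ($|\boldsymbol\alpha|<|\boldsymbol\beta|\Rightarrow\boldsymbol\alpha\prec\boldsymbol\beta$). For a set $\mathcal{A}=\{\boldsymbol\alpha_1\prec\cdots\prec\boldsymbol\alpha_m\}$, $\mathbf{V}_{\mathcal{A}}=[\mathbf{x}_i^{\boldsymbol\alpha_j}]_{i\le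 n,j\le m}$; $\mathbf{V}_{\le k}=\mathbf{V}_{\mathbb{P}_k}$, $\mathbf{V}_k=\mathbf{V}_{\mathbb{H}_k}$, so $\mathbf{V}_{\le k}=[\mathbf{V}_0\ \mathbf{V}_1\cdots\mathbf{V}_k]$. $K\in\mathcal{C}^{(k,k)}(\Omega\times\Omega)$ means all partial derivatives $K^{(\boldsymbol\alpha,\boldsymbol\beta)}=\partial_{\mathbf{x}}^{\boldsymbol\alpha}\partial_{\mathbf{y}}^{\boldsymbol\beta}K$ with $\boldsymbol\alpha,\boldsymbol\beta\in\mathbb{P}_k$ exist and are continuous on $\Omega\times\Omega$. Wronskian: $\mathbf{W}_k=\Big[\frac{K^{(\boldsymbol\alpha,\boldsymbol\beta)}(\mathbf{0},\mathbf{0})}{\boldsymbol\alpha!\boldsymbol\beta!}\Big]_{\boldsymbol\alpha,\boldsymbol\beta\in\mathbb{P}_k}$ (rows/columns in the chosen order). $M(k,d)=\sum_{\boldsymbol\alpha\in\mathbb{P}_k}|\boldsymbol\alpha|=d\binom{k+d}{d+1}$. Full QR factorization of $\mathbf{V}\in\mathbb{R}^{n\times m}$: $\mathbf{V}=\mathbf{Q}_{\rm full}\begin{bmatrix}\mathbf{R}\\\mathbf{0}\end{bmatrix}$, $\mathbf{Q}_{\rm full}$ orthogonal, $\mathbf{R}$ upper triangular. *)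

(* Defs.v *)
From HB Require Import structures.
From mathcomp Require Import all_boot all_order all_algebra.
From mathcomp Require Import all_classical all_reals all_analysis.
Set Implicit Arguments. Unset Strict Implicit. Unset Printing Implicit Defensive.
Import Order.TTheory GRing.Theory Num.Theory.
Import numFieldNormedType.Exports.
Local Open Scope classical_set_scope.
Local Open Scope ring_scope.

Definition mi (d : nat) := {ffun 'I_d -> nat}.

Definition mabs d (a : mi d) : nat := (\sum_(i < d) a i)%N.
Definition mfact d (a : mi d) : nat := (\prod_(i < d) (a i)`!)%N.
Definition mono (R : nzRingType) d (x : 'rV[R]_d) (a : mi d) : R :=
  \prod_(i < d) x 0 i ^+ a i.

(* #P_k = C(k+d, d), #H_k = C(k+d-1, d-1), M(k,d) = d C(k+d, d+1) *)
Definition NP (d k : nat) : nat := 'C(k + d, d).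
Definition NH (d k : nat) : nat := 'C(k + d - 1, d - 1).
Definition Mkd (k d : nat) : nat := (d * 'C(k + d, d.+1))%N.

(* A graded total order on P_k, given by its increasing enumeration
   e 0, e 1, ..., e (#P_k - 1) : a bijection from {0,..,#P_k-1} onto P_k
   which is nondecreasing in |.|.  *)
Definition graded_enum d k (e : nat -> mi d) : Prop :=
  [/\ (forall i j, (i < NP d k)%N -> (j < NP d k)%N -> e i = e j -> i = j),
      (forall i, (i < NP d k)%N -> (mabs (e i) <= k)%N),
      (forall a : mi d, (mabs a <= k)%N -> exists2 i, (i < NP d k)%N & e i = a) &
      (forall i j, (i <= j)%N -> (j < NP d k)%N -> (mabs (e i) <= mabs (e j))%N)].

Definition Vmx (R : nzRingType) d n (e : nat -> mi d) (X : 'I_n -> 'rV[R]_d) p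
  : 'M[R]_(n, p) := \matrix_(i < n, j < p) mono (X i) (e j).

Section Deriv.
Variable R : realType.
Variable d : nat.
Implicit Types (F : 'rV[R]_d -> 'rV[R]_d -> R).

Definition pd (v : bool * 'I_d) F : 'rV[R]_d -> 'rV[R]_d -> R :=
  if v.1 then fun x y => derive (fun z => F z y) x (delta_mx 0 v.2)
  else fun x y => derive (fun z => F x z) y (delta_mx 0 v.2).

Definition pd_exists (v : bool * 'I_d) F x y : Prop :=
  if v.1 then derivable (fun z => F z y) x (delta_mx 0 v.2)
  else derivable (fun z => F x z) y (delta_mx 0 v.2).

(* The sequence of elementary derivatives making up d_x^alpha d_y^beta
   (the rightmost one is applied first: first d_y^beta, then d_x^alpha;
   d^alpha = d_1^{alpha_1} ... d_d^{alpha_d}). *)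
Definition dseq (a b : mi d) : seq (bool * 'I_d) :=
  flatten [seq nseq (a i) (true, i) | i <- enum 'I_d] ++
  flatten [seq nseq (b i) (false, i) | i <- enum 'I_d].

Definition dfold (s : seq (bool * 'I_d)) F := foldr pd F s.

Definition Kder (a b : mi d) F := dfold (dseq a b) F.

Fixpoint chain_exists (D : set 'rV[R]_d) (s : seq (bool * 'I_d)) F : Prop :=
  match s with
  | [::] => True
  | v :: t => chain_exists D t F /\
              (forall x y, D x -> D y -> pd_exists v (dfold t F) x y)
  end.

Definition Cmm (m : nat) (D : set 'rV[R]_d) F : Prop :=
  forall a b : mi d, (mabs a <= m)%N -> (mabs b <= m)%N ->
    chain_exists D (dseq a b) F /\
    (forall x y, D x -> D y ->
       {for (x, y), continuous (fun p : 'rV[R]_d * 'rV[R]_d => Kder a b F p.1 p.2)}).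

Definition Wr k (e : nat -> mi d) F : 'M[R]_(NP d k) :=
  \matrix_(a < NP d k, b < NP d k)
     (Kder (e a) (e b) F 0 0 / ((mfact (e a))%:R * (mfact (e b))%:R)).

Definition Keps n (X : 'I_n -> 'rV[R]_d) F (eps : R) : 'M[R]_n :=
  \matrix_(i, j) F (eps *: X i) (eps *: X j).

End Deriv.

Definition eps_expand (R : realType) (f : R -> R) (m : nat) (c : R) : Prop :=
  exists C delta : R, 0 < delta /\
    forall eps : R, 0 < `|eps| < delta ->
      `|f eps - eps ^+ m * c| <= C * `|eps| ^+ m.+1.

Definition psdmx (R : realType) n (A : 'M[R]_n) : Prop :=
  A^T = A /\ forall v : 'cV[R]_n, 0 <= (v^T *m A *m v) 0 0.

Definition eigs_noninc (R : realType) n (A : 'M[R]_n) (lam : 'I_n -> R) : Prop :=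
  char_poly A = \prod_(i < n) ('X - (lam i)%:P) /\
  (forall i j : 'I_n, (i <= j)%N -> lam j <= lam i).

(* Main.v *)
(* Let [V(eps)] be the matrix of the monomials of degree at most [k] at the points
   [eps x_i], so that [V(eps) = V D(eps)] with [D(eps) = diag(eps ^ |a|)]. Expanding
   [K] to order [k] in both variables gives
     [K_eps = V(eps) W V(eps)^T + eps^(k+1) (V(eps) W1 + W2 V(eps)^T) + eps^(2k+2) W3]
   with [W1], [W2], [W3] bounded. [Cmm] provides the derivatives in one fixed order
   only; Schwarz's theorem lets them be taken in any order, so that they form a
   family indexed by multi-indices on which [d/dx_j] and [d/dy_j] act as shifts,
   and Taylor's bound follows by induction on the order. If an invertible [P] makes [P V] block triangular
   with respect to the degree, then [P V(eps) = diag(eps ^ |a_i|) (B + O(eps))], where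
   [B] keeps the entries of [P V] whose row and column have the same degree; hence
   [det(P)^2 det(K_eps) = eps ^ (2 sum_i |a_i|) (det(B W B^T) + O(eps))]. An LU
   factorisation provides [P] when [V] is square, the orthogonal factor of
   [V_{<= k-1}] provides it otherwise. For the eigenvalues, a row vector [u] with
   [u V_{<= s-1} = 0] satisfies [u V(eps) = O(eps^s)], hence
   [u K_eps u^T = O(eps^(2s)) |u|^2] on a subspace of codimension at most
   [#P_(s-1)], and the Courant-Fischer principle applies. *)

Require Import Defs.
From HB Require Import structures.
From mathcomp Require Import all_boot all_order all_algebra.
From mathcomp Require Import all_classical all_reals all_analysis.
From mathcomp Require Import perm zify ring lra.
Import Order.TTheory GRing.Theory Num.Theory.
Import numFieldNormedType.Exports.
Local Open Scope classical_set_scope.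
Local Open Scope ring_scope.
Set Implicit Arguments.
Unset Strict Implicit.
Unset Printing Implicit Defensive.

(** * Graded enumerations of multi-indices *)

Definition incr d (a : mi d) (j : 'I_d) : mi d := [ffun i => a i + (i == j)]%N.

Definition mi0 d : mi d := [ffun => 0%N].

(** The set $\mathbb{P}_k$ as a duplicate-free list. A coordinate never exceeds the degree, so
    tuples over ['I_k.+1] reach every element, and their number is a known binomial coefficient. *)
Definition mis d k : seq (mi d) :=
  [seq [ffun i => tnth t i : nat] | t : d.-tuple 'I_k.+1 <-
    enum [set t : d.-tuple 'I_k.+1 | (\sum_(i <- t) i <= k)%N]%SET].

Lemma leq_mabs d (a : mi d) i : (a i <= mabs a)%N.
Proof. by rewrite /mabs (bigD1 i) //= leq_addr. Qed.

Lemma mabs0 d : mabs (mi0 d) = 0%N.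
Proof. by rewrite /mabs big1 // => i _; rewrite ffunE. Qed.

Lemma mabs_incr d (a : mi d) j : mabs (incr a j) = (mabs a).+1.
Proof.
rewrite /mabs; under eq_bigr do rewrite ffunE.
rewrite big_split /= (bigD1 j) //= [X in (_ + X)%N](bigD1 j) //= eqxx.
by rewrite [X in (_ + (1 + X))%N]big1 ?addn0 ?addn1 // => i /negPf ->.
Qed.

Lemma mabs_tuple d k (t : d.-tuple 'I_k) :
  mabs [ffun i => tnth t i : nat] = (\sum_(i <- t) i)%N.
Proof. by rewrite big_tuple; apply: eq_bigr => i _; rewrite ffunE. Qed.

Lemma mem_mis d k (a : mi d) : (a \in mis d k) = (mabs a <= k)%N.
Proof.
apply/mapP/idP => [[t]|ak]; first by rewrite mem_enum inE -mabs_tuple => + ->.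
have aE : a = [ffun i => tnth [tuple inord (a i) : 'I_k.+1 | i < d] i : nat].
  apply/ffunP => i; rewrite !ffunE tnth_mktuple inordK //.
  by rewrite ltnS (leq_trans (leq_mabs a i)).
exists [tuple inord (a i) : 'I_k.+1 | i < d] => //.
by rewrite mem_enum inE -mabs_tuple -aE.
Qed.

Lemma uniq_mis d k : uniq (mis d k).
Proof.
rewrite map_inj_uniq ?enum_uniq // => s t /ffunP st.
by apply/eq_from_tnth => i; apply/val_inj; move: (st i); rewrite !ffunE.
Qed.

Lemma size_mis d k : size (mis d k) = NP d k.
Proof. by rewrite size_map -cardE card_partial_ord_partitions addnC. Qed.

Section GradedEnum.
Variables (d k : nat) (e : nat -> mi d).
Hypothesis e_graded : graded_enum k e.

Lemma graded_perm : perm_eq (mis d k) [seq e i | i <- iota 0 (NP d k)].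
Proof.
have [e_inj e_le e_surj _] := e_graded; apply: uniq_perm; first exact: uniq_mis.
  rewrite map_inj_in_uniq ?iota_uniq // => i j.
  by rewrite !mem_iota !add0n /= => ? ?; exact: e_inj.
move=> a; rewrite mem_mis; apply/idP/mapP => [/e_surj[i iN <-]|[i]].
  by exists i => //; rewrite mem_iota.
by rewrite mem_iota add0n => /= iN ->; exact: e_le.
Qed.

Lemma big_graded (T : Type) (idx : T) (op : Monoid.com_law idx) (F : mi d -> T) :
  \big[op/idx]_(a <- mis d k) F a = \big[op/idx]_(i < NP d k) F (e i).
Proof.
by rewrite (perm_big _ graded_perm) big_map -{1}[NP d k]subn0 big_mkord.
Qed.

Lemma NP_mono s t : (s <= t)%N -> (NP d s <= NP d t)%N.
Proof. by move=> st; rewrite /NP leq_bin2l // leq_add2r. Qed.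

Lemma graded_count s : (s <= k)%N ->
  (\sum_(i < NP d k) (mabs (e i) <= s))%N = NP d s.
Proof.
move=> sk; rewrite -(big_graded addn (fun a => (mabs a <= s)%N : nat)).
rewrite -size_mis -[RHS]sum1_size -big_mkcond -big_filter.
apply/perm_big/uniq_perm; rewrite ?filter_uniq ?uniq_mis // => a.
by rewrite mem_filter !mem_mis andb_idr // => /leq_trans; exact.
Qed.

(** Degrees are nondecreasing along [e], so the indices of degree at most [s] form an initial
    segment, and [graded_count] gives its length. *)
Lemma graded_leq s i : (s <= k)%N -> (i < NP d k)%N ->
  (mabs (e i) <= s)%N = (i < NP d s)%N.
Proof.
move=> sk iN; have [_ _ _ e_mono] := e_graded.
have NN : (NP d s <= NP d k)%N by exact: NP_mono.
have cnt := graded_count sk.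
rewrite -(big_mkord xpredT (fun i => (mabs (e i) <= s)%N : nat)) in cnt.
apply/idP/idP => [es|iNs].
  rewrite ltnNge; apply/negP => Ni; suff : (i.+1 <= NP d s)%N by rewrite ltnNge Ni.
  rewrite -cnt (big_cat_nat (n := i.+1)) //=.
  rewrite (eq_big_nat _ _ (F2 := fun=> 1%N)) => [|j /andP[_ ji]].
    by rewrite sum_nat_const_nat subn0 muln1 leq_addr.
  by rewrite (leq_trans _ es) ?e_mono.
rewrite leqNgt; apply/negP => es; suff : (NP d s <= i)%N by rewrite leqNgt iNs.
rewrite -[leqLHS]cnt (big_cat_nat (n := i)) ?(ltnW iN) //=.
rewrite [X in (_ + X)%N]big_nat_cond [X in (_ + X)%N]big1 ?addn0; last first.
  move=> j /andP[/andP[ij jN] _]; apply/eqP; rewrite eqb0 -ltnNge.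
  by rewrite (leq_trans es) ?e_mono.
by rewrite (leq_trans (leq_sum _ (fun j _ => leq_b1 _))) // sum_nat_const_nat subn0 muln1.
Qed.

(** Double counting: $|a| = k - \#\{s<k : |a|\le s\}$, and summing over $\mathbb{P}_k$ leaves
    $k\,\#\mathbb{P}_k - \sum_{s<k}\#\mathbb{P}_s$. *)
Lemma graded_sum : (\sum_(i < NP d k) mabs (e i))%N = Mkd k d.
Proof.
have [_ e_le _ _] := e_graded.
have H i : (i < NP d k)%N -> (mabs (e i) + \sum_(s < k) (mabs (e i) <= s) = k)%N.
  move=> iN; rewrite -(big_mkord xpredT (fun s => (mabs (e i) <= s)%N : nat)).
  rewrite (big_cat_nat (n := mabs (e i))) ?e_le //= big_nat_cond big1 => [|s]; last first.
    by case/andP=> /andP[_ si] _; rewrite leqNgt si.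
  rewrite add0n (eq_big_nat _ _ (F2 := fun=> 1%N)) => [|j /andP[-> _] //].
  by rewrite sum_nat_const_nat muln1 subnKC ?e_le.
have : (\sum_(i < NP d k) (mabs (e i) + \sum_(s < k) (mabs (e i) <= s)) = NP d k * k)%N.
  by rewrite (eq_bigr (fun=> k)) ?sum_nat_const ?card_ord // => i _; rewrite H.
rewrite big_split /= [X in (_ + X)%N]exchange_big /=.
under [X in (_ + X)%N]eq_bigr => s _ do rewrite graded_count ?(ltnW (ltn_ord s)) //.
have -> : (\sum_(s < k) NP d s = 'C(k + d, d.+1))%N.
  elim: k => [|m IH]; first by rewrite big_ord0 bin_small.
  by rewrite big_ord_recr /= IH /NP addSn binS.
(* Absorption, [(d + 1) C(k+d, d+1) = k C(k+d, d)], turns the difference into [d C(k+d, d+1)]. *)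
have := mul_bin_left (k + d) d; rewrite addnK /Mkd /NP => E1.
by lia.
Qed.

End GradedEnum.

(** * Commutation of partial derivatives *)

Lemma is_deriveE (R : realType) (V : normedModType R) (f : V -> R) a v l :
  is_derive a v f l <->
  (fun h : R => h^-1 * (f (h *: v + a) - f a)) @ 0^' --> l.
Proof.
split=> [[fa <-]|fl]; first exact: fa.
by split; [apply/cvg_ex; exists l | apply/cvg_lim].
Qed.

Lemma is_derive_line (R : realType) (V : normedModType R) (f : V -> R) a v s l :
  is_derive (s *: v + a) v f l <-> is_derive s 1 (fun t => f (t *: v + a)) l.
Proof.
rewrite !is_deriveE; have -> // : (fun h : R => h^-1 * (f (h *: v + (s *: v + a)) - f (s *: v + a))) =
  (fun h : R => h^-1 * (f ((h *: (1 : R) + s) *: v + a) - f (s *: v + a))).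
by apply/funext => h; rewrite addrA -scalerDl /GRing.scale /= mulr1.
Qed.

(** * Mean value theorem and Schwarz's theorem in two real parameters *)

Section OneVariable.
Variable R : realType.

(** Increments of either sign are covered: the two cases are the mean value theorem on [[0, c]] and
    on [[c, 0]]. *)
Lemma mean_value (f f' : R -> R) (c : R) :
  (forall t : R, `|t| <= `|c| -> is_derive t 1 f (f' t)) ->
  exists2 t, `|t| <= `|c| & f c - f 0 = c * f' t.
Proof.
move=> fd; have cf a b : (forall t : R, t \in `[a, b] -> `|t| <= `|c|) ->
    {within `[a, b], continuous f}.
  move=> ab; apply: derivable_within_continuous => t /ab /fd[].
  by [].
have [c0|/ltW c0] := leP 0 c.
  have H t : t \in `[0, c] -> `|t| <= `|c|.
    by rewrite in_itv /= => /andP[t0 tc]; rewrite !ger0_norm.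
  have [|t /H tc ->] := MVT_segment c0 (f := f) (df := f') _ (cf _ _ H).
    by move=> t /subset_itv_oo_cc /H; exact: fd.
  by exists t; rewrite // subr0 mulrC.
have H t : t \in `[c, 0] -> `|t| <= `|c|.
  by rewrite in_itv /= => /andP[t0 tc]; rewrite !ler0_norm // lerN2.
have [|t /H tc E] := MVT_segment c0 (f := f) (df := f') _ (cf _ _ H).
  by move=> t /subset_itv_oo_cc /H; exact: fd.
by exists t => //; move: E; rewrite sub0r => E; rewrite -opprB E mulrN opprK mulrC.
Qed.

(* The second difference of [phi] divided by [s * t] is a value of [g] near the
   origin; let first [s], then [t], tend to 0. *)
Lemma schwarz (phi f2 g : R -> R -> R) f1 (delta : R) : 0 < delta ->
  (forall t : R, `|t| < delta -> is_derive (0 : R) 1 (phi ^~ t) (f1 t)) ->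
  (forall s t : R, `|s| < delta -> `|t| < delta -> is_derive t 1 (phi s) (f2 s t)) ->
  (forall s t : R, `|s| < delta -> `|t| < delta -> is_derive s 1 (f2 ^~ t) (g s t)) ->
  (forall eta, 0 < eta -> exists2 r, 0 < r &
     forall s t : R, `|s| < r -> `|t| < r -> `|g s t - g 0 0| <= eta) ->
  is_derive (0 : R) 1 f1 (g 0 0).
Proof.
move=> delta0 phi1 phi2 f2d gc; rewrite is_deriveE.
apply/cvgrPdist_le => eta eta0; have [r r0 gr] := gc _ eta0.
near=> t; rewrite /GRing.scale /= mulr1 addr0.
have t0 : t != 0 by near: t; exact: nbhs_dnbhs_neq.
have tr : `|t| < Num.min r delta.
  by near: t; apply: dnbhs0_lt; rewrite lt_min r0.
move: (tr); rewrite lt_min => /andP[{}tr td].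
(* For fixed [t] the quantity to bound is a limit as [s] tends to 0, so it suffices to estimate the
   double difference quotient for small nonzero [s]. *)
have cvgs : (fun s => g 0 0 - t^-1 * (s^-1 * (phi s t - phi 0 t) - s^-1 * (phi s 0 - phi 0 0)))
    @ 0^' --> g 0 0 - t^-1 * (f1 t - f1 0).
  have H u : `|u| < delta -> (fun s => s^-1 * (phi s u - phi 0 u)) @ 0^' --> f1 u.
    move=> /phi1; rewrite is_deriveE /GRing.scale /=.
    by under eq_fun do rewrite mulr1 addr0.
  apply: cvgB; first exact: cvg_cst.
  by apply: cvgM; [exact: cvg_cst | apply: cvgB; apply: H; rewrite ?normr0].
apply: (cvgr_to_le (cvg_norm cvgs)).
near=> s.
have s0 : s != 0 by near: s; exact: nbhs_dnbhs_neq.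
have sr : `|s| < Num.min r delta.
  by near: s; apply: dnbhs0_lt; rewrite lt_min r0.
move: (sr); rewrite lt_min => /andP[{}sr sd].
(* The mean value theorem in [t] for [phi s - phi 0], then in [s] for [f2], turns the second
   difference into [s * t * g s' t']. *)
have [|t' t't E] := @mean_value (fun u => phi s u - phi 0 u) (fun u => f2 s u - f2 0 u) t.
  move=> u ut; apply: is_deriveB; apply: phi2; rewrite ?normr0 //;
  exact: le_lt_trans ut _.
have [|s' s's E'] := @mean_value (f2 ^~ t') (g ^~ t') s.
  by move=> u ut; apply: f2d; [exact: le_lt_trans ut _|exact: le_lt_trans t't _].
rewrite -mulrBr opprB (_ : phi s t - _ + _ = phi s t - phi 0 t - (phi s 0 - phi 0 0)); last by ring.
have -> : t^-1 * (s^-1 * (phi s t - phi 0 t - (phi s 0 - phi 0 0))) = g s' t'.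
  by rewrite E E'; field; rewrite s0 t0.
by rewrite distrC gr //; [exact: le_lt_trans s's _|exact: le_lt_trans t't _].
Unshelve. all: by end_near.
Qed.

End OneVariable.

Section Commutation.
Variables (R : realType) (d : nat).
Local Notation point := ('rV[R]_d * 'rV[R]_d)%type.
Implicit Types (F : 'rV[R]_d -> 'rV[R]_d -> R) (p : point) (u v w : bool * 'I_d).

Definition move_coord v (t : R) p : point :=
  if v.1 then (t *: delta_mx 0 v.2 + p.1, p.2) else (p.1, t *: delta_mx 0 v.2 + p.2).

Definition uncur F p : R := F p.1 p.2.

(** A partial derivative read as an ordinary derivative at 0 along a coordinate line of the product
    space, which treats both groups of variables alike. *)
Definition is_pd v (f : point -> R) p (l : R) :=
  is_derive (0 : R) 1 (fun t => f (move_coord v t p)) l.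

Lemma move_coord0 v p : move_coord v 0 p = p.
Proof. by case: p => x y; rewrite /move_coord; case: ifP; rewrite /= scale0r add0r. Qed.

Lemma move_coordC u v s t p :
  move_coord u s (move_coord v t p) = move_coord v t (move_coord u s p).
Proof. by rewrite /move_coord; case: ifP; case: ifP => //=; rewrite addrCA. Qed.

Lemma is_pd_move v f p s l :
  is_pd v f (move_coord v s p) l <-> is_derive s 1 (fun t => f (move_coord v t p)) l.
Proof.
rewrite /is_pd !is_deriveE.
have -> // : (fun h : R => h^-1 * (f (move_coord v (h *: 1 + 0) (move_coord v s p))
    - f (move_coord v 0 (move_coord v s p)))) =
  (fun h : R => h^-1 * (f (move_coord v (h *: (1 : R) + s) p) - f (move_coord v s p))).
apply/funext => h; rewrite move_coord0 addr0; congr (_ * (f _ - _)).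
by rewrite /move_coord; case: (v.1) => /=; rewrite addrA -scalerDl.
Qed.

Lemma is_pd_pd v F x y :
  pd_exists v F x y -> is_pd v (uncur F) (x, y) (pd v F x y).
Proof.
case: v => -[] j H.
  apply: (is_derive_line (F^~ y) x (delta_mx 0 j) 0 _).1.
  by rewrite scale0r add0r; split.
apply: (is_derive_line (F x) y (delta_mx 0 j) 0 _).1.
by rewrite scale0r add0r; split.
Qed.

Lemma norm_row_le (x : 'rV[R]_d) (r : R) :
  0 <= r -> (forall i, `|x 0 i| <= r) -> `|x| <= r.
Proof.
move=> r0 xr; rewrite /Num.Def.normr /= mx_normrE; apply: bigmax_le => // ij _.
by rewrite (ord1 ij.1).
Qed.

Lemma norm_coord_le (x : 'rV[R]_d) i : `|x 0 i| <= `|x|.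
Proof.
rewrite [in leRHS]/Num.Def.normr /= mx_normrE.
exact: (le_bigmax _ (fun ij => `|x ij.1 ij.2|) (0, i)).
Qed.

Lemma norm_scale_delta (t : R) j : `|t *: (delta_mx 0 j : 'rV[R]_d)| <= `|t|.
Proof.
apply: norm_row_le => // i; rewrite !mxE eqxx /=.
by case: (i == j); rewrite ?mulr1 ?mulr0 ?normr0.
Qed.

Lemma near_move_coord (U : set point) u v p : nbhs p U ->
  exists2 r : R, 0 < r & forall s t : R, `|s| < r -> `|t| < r ->
    U (move_coord v t (move_coord u s p)).
Proof.
have H w (t : R) q : `|q.1 - (move_coord w t q).1| <= `|t| /\
    `|q.2 - (move_coord w t q).2| <= `|t|.
  rewrite /move_coord; case: (w.1) => /=; rewrite subrr normr0 opprD addrCA subrr addr0 normrN;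
  by split => //; exact: norm_scale_delta.
move=> /nbhs_ballP[r /= r0 rU]; exists (r / 2); first by rewrite divr_gt0.
move=> s t sr tr; apply: rU.
have [H1 H2] := H u s p; have [H3 H4] := H v t (move_coord u s p).
split; rewrite -ball_normE /ball_ /=.
  rewrite -(subrKA (move_coord u s p).1) [ltRHS]splitr.
  by rewrite (le_lt_trans (ler_normD _ _)) // ltrD // ?(le_lt_trans H1) ?(le_lt_trans H3).
rewrite -(subrKA (move_coord u s p).2) [ltRHS]splitr.
by rewrite (le_lt_trans (ler_normD _ _)) // ltrD // ?(le_lt_trans H2) ?(le_lt_trans H4).
Qed.

(** [schwarz] applied to the function of two parameters that moves [p] by [s] along [u] and by [t]
    along [v]. The existence of the derivative of [fu] along [v] is part of the conclusion. *)
Lemma is_pd_comm u v (D : set point) (f fu fv fuv : point -> R) p :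
  nbhs p D ->
  (forall q, D q -> is_pd u f q (fu q)) ->
  (forall q, D q -> is_pd v f q (fv q)) ->
  (forall q, D q -> is_pd u fv q (fuv q)) ->
  {for p, continuous fuv} ->
  is_pd v fu p (fuv p).
Proof.
move=> pD fP fvP fuvP fuvc; have [r r0 rD] := near_move_coord u v pD.
have /= := @schwarz R (fun s t => f (move_coord v t (move_coord u s p)))
   (fun s t => fv (move_coord v t (move_coord u s p)))
   (fun s t => fuv (move_coord v t (move_coord u s p)))
   (fun t => fu (move_coord v t p)) r r0.
rewrite !move_coord0; apply.
- move=> t tr; under eq_fun do rewrite move_coordC.
  by apply/fP; have := rD 0 t; rewrite move_coord0 normr0; exact.
- by move=> s t sr tr; apply/is_pd_move/fvP/rD.
- move=> s t sr tr; under eq_fun do rewrite move_coordC.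
  apply/is_pd_move; rewrite move_coordC; exact/fuvP/rD.
- move=> eta eta0; have /cvgrPdist_le/(_ _ eta0) := fuvc.
  move=> /near_move_coord-/(_ u v)[r' r'0 H]; exists r' => // s t sr tr.
  by rewrite distrC H.
Qed.

(** * Sorted words of elementary derivatives *)

Definition key v : nat := if v.1 then v.2 : nat else (d + v.2)%N.
(** The order in which [dseq] lists its letters: derivatives in [x] by coordinate, then derivatives
    in [y] by coordinate. *)
Definition le_key u v := (key u <= key v)%N.

Fixpoint ins v (l : seq (bool * 'I_d)) :=
  if l is u :: s then if le_key v u then v :: l else u :: ins v s else [:: v].

Lemma key_inj : injective key.
Proof.
move=> [[] i] [[] j]; rewrite /key /= => E.
- by congr pair; apply: val_inj.
- by have := ltn_ord i; rewrite E ltnNge leq_addr.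
- by have := ltn_ord j; rewrite -E ltnNge leq_addr.
- by congr pair; apply: val_inj; exact: addnI E.
Qed.

Lemma le_key_trans : transitive le_key.
Proof. by move=> u v w; exact: leq_trans. Qed.

Lemma le_key_anti : antisymmetric le_key.
Proof. by move=> u v /anti_leq/key_inj. Qed.

Lemma perm_ins v l : perm_eq (ins v l) (v :: l).
Proof.
elim: l => //= u s IH; case: ifP => // _; rewrite -(perm_cons u) in IH.
by rewrite (perm_trans IH) // (perm_catCA [:: u] [:: v]).
Qed.

Lemma ins_sorted v l : sorted le_key l -> sorted le_key (ins v l).
Proof.
elim: l => //= u s IH us; case: ifP => [vu|/negbT]; first by rewrite /= vu.
rewrite {1}/le_key -ltnNge => /ltnW uv; move: us.
rewrite (path_sortedE le_key_trans) => /andP[us /IH vs].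
rewrite [sorted _ _]/= (path_sortedE le_key_trans) vs andbT (perm_all _ (perm_ins v s)) /=.
by rewrite us andbT.
Qed.

Lemma sorted_dseq (a b : mi d) : sorted le_key (dseq a b).
Proof.
(* [us] lists all letters in increasing order and [dseq a b] repeats each of them, so sortedness
   follows by induction on [us]. *)
pose us := [seq (true, i) | i <- enum 'I_d] ++ [seq (false, i) | i <- enum 'I_d].
have -> : dseq a b = flatten [seq nseq (if v.1 then a v.2 else b v.2) v | v <- us].
  by rewrite /us map_cat flatten_cat; congr (flatten _ ++ flatten _); rewrite -[RHS]map_comp.
rewrite (sorted_pairwise le_key_trans).
have : pairwise le_key us.
  have I : pairwise (fun i j : 'I_d => (i <= j)%N) (enum 'I_d).
    rewrite -(pairwise_map val) val_enum_ord -(sorted_pairwise leq_trans).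
    exact: iota_sorted.
  rewrite pairwise_cat (pairwise_map (pair true)) (pairwise_map (pair false)); apply/and3P; split.
  - apply/allrelP => _ _ /mapP[i _ ->] /mapP[j _ ->].
    by rewrite /le_key /key /= (leq_trans (ltnW (ltn_ord i))) // leq_addr.
  - exact: I.
  - by apply: sub_pairwise I => i j; rewrite /relpre /le_key /key /= leq_add2l.
elim: us => //= u us IH /andP[uus /IH {}IH]; rewrite pairwise_cat IH andbT.
apply/andP; split.
  apply/allrelP => x y; rewrite mem_nseq => /andP[_ /eqP ->].
  by move=> /flatten_mapP[w /(allP uus) uw]; rewrite mem_nseq => /andP[_ /eqP ->].
by elim: (if _ then _ else _) => //= n ->; rewrite all_nseq /le_key leqnn orbT.
Qed.

Lemma count_dseq (a b : mi d) v :
  count_mem v (dseq a b) = if v.1 then a v.2 else b v.2.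
Proof.
have H (c : mi d) (w : bool) : count_mem v (flatten [seq nseq (c i) (w, i) | i <- enum 'I_d]) =
    ((v.1 == w) * c v.2)%N.
  rewrite count_flatten -map_comp sumnE big_map big_enum /= (bigD1 v.2) //= big1 ?addn0.
    by case: v => x y; rewrite count_nseq /= xpair_eqE eqxx andbT eq_sym.
  move=> i /negPf iv; rewrite count_nseq /=; case: v iv => x y /= iv.
  by rewrite xpair_eqE iv andbF.
by rewrite count_cat !H; case: (v.1); rewrite ?mul1n ?mul0n ?addn0.
Qed.

Definition mi_count (x : bool) (l : seq (bool * 'I_d)) : mi d :=
  [ffun i => count_mem (x, i) l].

Lemma mabs_mi_count x l : mabs (mi_count x l) = count (fun v => v.1 == x) l.
Proof.
rewrite /mabs; under eq_bigr do rewrite ffunE.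
elim: l => [|v l IH] /=; first by rewrite big1.
rewrite big_split /= IH; congr addn; case: v => y j /=.
rewrite (bigD1 j) //= big1 ?addn0 => [|i /negPf ij]; first by rewrite xpair_eqE eqxx andbT.
by rewrite xpair_eqE eq_sym [j == i]eq_sym ij andbF.
Qed.

(** Sorted words with the same multiplicities coincide, so the words covered by [Cmm] are all the
    sorted ones within the degree bounds. *)
Lemma dseq_mi_count l : sorted le_key l -> l = dseq (mi_count true l) (mi_count false l).
Proof.
move=> ls; apply: (sorted_eq le_key_trans le_key_anti) => //; first exact: sorted_dseq.
by rewrite /perm_eq; apply/allP => -[[] i] _; rewrite /= count_dseq /= ffunE.
Qed.

(** Raising one coordinate of a multi-index adds one letter to the word, and a sorted word is
    determined by its letters. *)
Lemma dseq_ins (a b a' b' : mi d) v :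
  (forall i, a' i = a i + ((true, i) == v))%N ->
  (forall i, b' i = b i + ((false, i) == v))%N ->
  dseq a' b' = ins v (dseq a b).
Proof.
move=> aE bE; have sI := ins_sorted v (sorted_dseq a b).
apply: (sorted_eq le_key_trans le_key_anti) => //; first exact: sorted_dseq.
rewrite perm_sym (perm_trans (perm_ins _ _)) // /perm_eq.
apply/allP => u _; rewrite [pred1]lock /= -lock !count_dseq /=.
by case: u => -[] i /=; rewrite ?aE ?bE [v == _]eq_sym addnC.
Qed.

End Commutation.

(** * Derivatives of the kernel as a family on which differentiation shifts *)

Section SmoothKernel.
Variables (R : realType) (d m : nat) (Omega : set 'rV[R]_d).
Variable K : 'rV[R]_d -> 'rV[R]_d -> R.
Hypotheses (openO : open Omega) (K_smooth : Cmm m Omega K).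

Let D := Omega `*` Omega.

(** The words that [Cmm] controls: letters in the fixed order, at most [m] of them in each group of
    variables. *)
Definition small_word (l : seq (bool * 'I_d)) :=
  sorted (@le_key d) l && all (fun x => count (fun v => v.1 == x) l <= m)%N [:: true; false].

Let small_wordW v l : small_word (v :: l) -> small_word l.
Proof.
case/andP => /path_sorted lv /and3P[h1 h2 _].
rewrite /small_word lv /= (leq_trans _ h1) ?(leq_trans _ h2) //=; exact: leq_addl.
Qed.

Let small_word_ins v u l : small_word (u :: l) -> small_word (ins v (u :: l)) ->
  small_word (ins v l).
Proof.
rewrite /= => ul; case: ifP => [_|_]; last exact: small_wordW.
case/andP => _ /= /and3P[h1 h2 _].
rewrite /small_word ins_sorted; last by move: (small_wordW ul) => /andP[].
rewrite /= !(seq.permP (perm_ins v l)) /=.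
by rewrite (leq_trans _ h1) ?(leq_trans _ h2) //= leq_add2l leq_addl.
Qed.

Let small_word_chain l : small_word l -> chain_exists Omega l K.
Proof.
case/andP => ls /and3P[h1 h2 _]; rewrite (dseq_mi_count ls).
by have [] := K_smooth (a := mi_count true l) (b := mi_count false l); rewrite ?mabs_mi_count.
Qed.

Let small_word_continuous l p : small_word l -> D p ->
  {for p, continuous (uncur (dfold l K))}.
Proof.
case/andP => ls /and3P[h1 h2 _] [p1 p2]; rewrite (dseq_mi_count ls).
have [|| _] := K_smooth (a := mi_count true l) (b := mi_count false l); rewrite ?mabs_mi_count //.
by move=> /(_ _ _ p1 p2); rewrite -surjective_pairing.
Qed.

Lemma openD p : D p -> nbhs p D.
Proof.
move=> [p1 p2]; exists (Omega, Omega) => //=.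
by split; apply: open_nbhs_nbhs; split.
Qed.

Let is_pd_word v l p : small_word (v :: l) -> D p ->
  is_pd v (uncur (dfold l K)) p (uncur (dfold (v :: l) K) p).
Proof.
move=> /small_word_chain[_ H] [p1 p2].
by have /is_pd_pd := H _ _ p1 p2; rewrite -surjective_pairing.
Qed.

(** Induction on the word. If [v] has to pass the head [u], [is_pd_comm] applies to [dfold l K]: the
    induction hypothesis differentiates it along [v], and the words [u :: l] and [u :: ins v l] are
    both covered by [Cmm]. *)
Lemma is_pd_ins v l p : small_word l -> small_word (ins v l) -> D p ->
  is_pd v (uncur (dfold l K)) p (uncur (dfold (ins v l) K) p).
Proof.
elim: l p => [|u l IH] p; first by move=> _; exact: is_pd_word.
move=> ul vul Dp; have vl := small_word_ins ul vul.
move: vul; rewrite [ins v _]/=; case: ifP => [_|_] vul; first exact: is_pd_word.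
apply: (is_pd_comm (openD Dp)) (small_word_continuous vul Dp).
- by move=> q; exact: is_pd_word.
- by move=> q; exact: IH (small_wordW ul) vl.
- by move=> q; exact: is_pd_word.
Qed.

Lemma small_word_dseq (a b : mi d) : (mabs a <= m)%N -> (mabs b <= m)%N ->
  small_word (dseq a b).
Proof.
move=> am bm; rewrite /small_word sorted_dseq /= -!mabs_mi_count.
have -> : mi_count true (dseq a b) = a by apply/ffunP => i; rewrite ffunE count_dseq.
have -> : mi_count false (dseq a b) = b by apply/ffunP => i; rewrite ffunE count_dseq.
by rewrite am bm.
Qed.

Lemma Kder_is_derive_l (a b : mi d) j x y :
  (mabs a < m)%N -> (mabs b <= m)%N -> Omega x -> Omega y ->
  is_derive x (delta_mx 0 j) (fun z => Kder a b K z y) (Kder (incr a j) b K x y).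
Proof.
move=> am bm xO yO.
have E : dseq (incr a j) b = ins (true, j) (dseq a b).
  by apply: dseq_ins => i; rewrite ?ffunE ?addn0 // xpair_eqE.
have := @is_pd_ins (true, j) (dseq a b) (x, y).
rewrite -E => /(_ (small_word_dseq (ltnW am) bm)).
rewrite small_word_dseq ?mabs_incr // => /(_ isT (conj xO yO)).
rewrite -[X in is_derive X](add0r x) -(scale0r (delta_mx 0 j)) /is_pd /=.
by move=> H; apply/is_derive_line.
Qed.

Lemma Kder_is_derive_r (a b : mi d) j x y :
  (mabs a <= m)%N -> (mabs b < m)%N -> Omega x -> Omega y ->
  is_derive y (delta_mx 0 j) (Kder a b K x) (Kder a (incr b j) K x y).
Proof.
move=> am bm xO yO.
have E : dseq a (incr b j) = ins (false, j) (dseq a b).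
  by apply: dseq_ins => i; rewrite ?ffunE ?addn0 // xpair_eqE.
have := @is_pd_ins (false, j) (dseq a b) (x, y).
rewrite -E => /(_ (small_word_dseq am (ltnW bm))).
rewrite small_word_dseq ?mabs_incr // => /(_ isT (conj xO yO)).
rewrite -[X in is_derive X](add0r y) -(scale0r (delta_mx 0 j)) /is_pd /=.
by move=> H; apply/is_derive_line.
Qed.

Lemma Kder_bounded : Omega 0 -> exists r M : R, [/\ 0 < r, 0 <= M,
  (forall x, `|x| < r -> Omega x) &
  forall a b x y, (mabs a <= m)%N -> (mabs b <= m)%N -> `|x| < r -> `|y| < r ->
    `|Kder a b K x y| <= M].
Proof.
move=> O0; have D0 : D (0, 0) by [].
pose s := [seq (a, b) | a <- mis d m, b <- mis d m].
(* Near the origin each of the finitely many derivatives exceeds its absolute value there by at most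
   1; the sum of these bounds dominates each one. *)
pose M := \sum_(c <- s) (`|Kder c.1 c.2 K 0 0| + 1).
have M0 c : 0 <= `|Kder c.1 c.2 K 0 0| + 1 by rewrite addr_ge0.
have : \forall p \near (0 : 'rV[R]_d, 0 : 'rV[R]_d), D p /\
    forall c, c \in s -> `|uncur (Kder c.1 c.2 K) p| <= `|Kder c.1 c.2 K 0 0| + 1.
  apply: filterI; first exact: openD.
  have : {in s, forall c, mabs c.1 <= m /\ mabs c.2 <= m}%N.
    by move=> _ /allpairsP[c [c1 c2 ->]] /=; rewrite -!mem_mis.
  elim: (s) => [|c t IH] sm; first by near=> p.
  have {}IH : _ := IH (sub_in1 (@mem_behead _ (c :: t)) sm).
  have [cm1 cm2] := sm c (mem_head _ _).
  have := small_word_continuous (small_word_dseq cm1 cm2) D0.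
  move=> /cvgrPdist_le/(_ _ ltr01) H.
  near=> p => c'; rewrite inE => /predU1P[->|]; last by move: c'; near: p.
  have : `|Kder c.1 c.2 K 0 0 - uncur (Kder c.1 c.2 K) p| <= 1 by near: p.
  rewrite -lerBlDl; apply: le_trans; rewrite distrC.
  exact: lerB_dist.
move=> /nbhs_ballP[r /= r0 rD]; exists r, M.
have rb x y : `|x| < r -> `|y| < r -> ball (0 : 'rV[R]_d, 0 : 'rV[R]_d) r (x, y).
  by split; rewrite -ball_normE /ball_ /= sub0r normrN.
split => //; first by apply: sumr_ge0.
  by move=> x xr; have [[]] := rD _ (rb _ _ xr xr).
move=> a b x y am bm xr yr; have [_ /(_ (a, b))] := rD _ (rb _ _ xr yr).
have abs : (a, b) \in s by apply: allpairs_f; rewrite mem_mis.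
by move=> /(_ abs)/le_trans; apply; rewrite /M (big_rem _ abs) /= lerDl sumr_ge0.
Unshelve. all: by end_near.
Qed.

End SmoothKernel.

(** * Taylor expansion of families of derivatives *)

Definition decr d (a : mi d) (j : 'I_d) : mi d := [ffun i => a i - (i == j)]%N.

Lemma incrK d (a : mi d) j : decr (incr a j) j = a.
Proof. by apply/ffunP => i; rewrite !ffunE addnK. Qed.

Lemma decrK d (a : mi d) j : a j != 0%N -> incr (decr a j) j = a.
Proof.
move=> aj; apply/ffunP => i; rewrite !ffunE subnK //.
by case: eqVneq => // ->; rewrite lt0n.
Qed.

Lemma incrC d (a : mi d) i j : incr (incr a i) j = incr (incr a j) i.
Proof. by apply/ffunP => l; rewrite !ffunE addnAC. Qed.

Lemma incr_inj d (j : 'I_d) : injective (fun a : mi d => incr a j).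
Proof. by move=> a b /(congr1 (fun c => decr c j)); rewrite !incrK. Qed.

Section Taylor.
Variables (R : realType) (d : nat).
Implicit Types (x z : 'rV[R]_d) (a : mi d).

Lemma is_derive_bigsum (I : eqType) (s : seq I) (F : I -> 'rV[R]_d -> R) (dF : I -> R) x v :
  (forall i, i \in s -> is_derive x v (F i) (dF i)) ->
  is_derive x v (fun z => \sum_(i <- s) F i z) (\sum_(i <- s) dF i).
Proof.
elim: s => [|i s IH] H.
  by rewrite big_nil; under eq_fun do rewrite big_nil; exact: is_derive_cst.
rewrite big_cons; under eq_fun do rewrite big_cons.
apply: is_deriveD; first by apply: H; rewrite mem_head.
by apply: IH => k ks; apply: H; rewrite in_cons ks orbT.
Qed.

(** A staircase from 0 to [x] changes one coordinate at a time, and each of its [d] steps obeys the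
    one-variable mean value theorem. The norm is the maximum norm, so the path stays in the ball of
    radius [|x|]. *)
Lemma mean_value_box (h : 'rV[R]_d -> R) (dh : 'I_d -> 'rV[R]_d -> R) x (B : R) :
  (forall z j, `|z| <= `|x| -> is_derive z (delta_mx 0 j) h (dh j z)) ->
  (forall z j, `|z| <= `|x| -> `|dh j z| <= B) ->
  `|h x - h 0| <= d%:R * B * `|x|.
Proof.
move=> hd hB; pose y (n : nat) : 'rV[R]_d := \row_i (if (i < n)%N then x 0 i else 0).
have y0 : y 0%N = 0 by apply/rowP => i; rewrite !mxE.
have yd : y d = x by apply/rowP => i; rewrite !mxE ltn_ord.
rewrite -y0 -[in h x]yd -(telescope_sumr (fun n => h (y n)) (leq0n d)) big_mkord.
apply: (le_trans (ler_norm_sum _ _ _)).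
have -> : d%:R * B * `|x| = \sum_(i < d) B * `|x|.
  by rewrite sumr_const card_ord -[RHS]mulr_natl mulrA.
apply: ler_sum => i _.
have yS t : `|t| <= `|x 0 i| -> `|t *: delta_mx 0 i + y i| <= `|x|.
  move=> tx; apply: norm_row_le => // l; rewrite !mxE eqxx /=.
  have [->|li] := eqVneq l i.
    by rewrite ltnn mulr1 addr0 (le_trans tx) ?norm_coord_le.
  by rewrite mulr0 add0r; case: ifP; rewrite ?normr0 // norm_coord_le.
have [|t tx] := @mean_value R (fun t => h (t *: delta_mx 0 i + y i))
  (fun t => dh i (t *: delta_mx 0 i + y i)) (x 0 i).
  by move=> t tx; apply: (is_derive_line h (y i) (delta_mx 0 i) t _).1; exact/hd/yS.
rewrite scale0r add0r => E.
have -> : y i.+1 = x 0 i *: delta_mx 0 i + y i.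
  apply/rowP => l; rewrite !mxE eqxx ltnS leq_eqVlt /=.
  have [/val_inj ->|li] := eqVneq (l : nat) i; first by rewrite eqxx ltnn mulr1 addr0.
  by rewrite -[l == i](inj_eq val_inj) (negPf li) mulr0 add0r.
rewrite E normrM mulrC ler_pM // ?norm_coord_le //; exact/hB/yS.
Qed.

(* The monomial [x^a / a!], normalised so that differentiation shifts [a]. *)
Definition tmono a x : R := mono x a / (mfact a)%:R.

Lemma tmonoE a x : tmono a x = \prod_(i < d) (x 0 i ^+ a i / (a i)`!%:R).
Proof. by rewrite big_split /= prodfV /tmono /mono /mfact natr_prod. Qed.

Lemma tmono_move a x j (t : R) : tmono a (t *: delta_mx 0 j + x) =
  (\prod_(i < d | i != j) (x 0 i ^+ a i / (a i)`!%:R) / (a j)`!%:R) * (t + x 0 j) ^+ a j.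
Proof.
rewrite tmonoE (bigD1 j) //= !mxE !eqxx mulr1.
rewrite (eq_bigr (fun i => x 0 i ^+ a i / (a i)`!%:R)).
  by rewrite mulrAC -mulrA mulrC.
by move=> i /negPf ij; rewrite !mxE ij /= mulr0 add0r.
Qed.

(** [decr] truncates at 0; the factor [(a j != 0)] accounts for monomials that do not contain the
    coordinate [j]. *)
Lemma is_derive_tmono a x j :
  is_derive x (delta_mx 0 j) (tmono a) ((a j != 0%N)%:R * tmono (decr a j) x).
Proof.
suff : is_derive (0 *: delta_mx 0 j + x) (delta_mx 0 j) (tmono a)
    ((a j != 0%N)%:R * tmono (decr a j) x) by rewrite scale0r add0r.
apply: (is_derive_line (tmono a) x (delta_mx 0 j) 0 _).2.
under eq_fun do rewrite tmono_move.
set c := _ / _.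
have tH : is_derive (0 : R) 1 (fun t : R => t + x 0 j) 1.
  by rewrite -[1 in X in is_derive _ _ _ X]addr0; apply: is_deriveD.
have H := is_deriveM (is_derive_cst c (0 : R) 1) (is_deriveX (a j) tH).
rewrite exprfctE in H; apply: (is_derive_eq H).
rewrite scaler0 addr0 /cst add0r /GRing.scale /= mulr1 /c.
have [->|aj] := eqVneq (a j) 0%N; first by rewrite !mul0r mulr0.
rewrite mul1r -[x in RHS]add0r -(scale0r (delta_mx 0 j)) tmono_move add0r.
rewrite ffunE eqxx; under [in RHS]eq_bigr => i /negPf ij do rewrite ffunE ij subn0.
case: (a j) aj => // n _; rewrite subn1 factS natrM /=; field.
by rewrite pnatr_eq0 -lt0n fact_gt0 addrC natr1 pnatr_eq0.
Qed.

(** The degree bound is strict, so that the Taylor induction starts from the empty sum. *)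
Definition mis_lt k : seq (mi d) := if k is k'.+1 then mis d k' else [::].

Lemma mem_mis_lt k a : (a \in mis_lt k) = (mabs a < k)%N.
Proof. by case: k => // k; rewrite mem_mis. Qed.

Lemma perm_mis_lt k (j : 'I_d) :
  perm_eq [seq a : mi d <- mis_lt k.+1 | a j != 0%N] [seq incr b j | b <- mis_lt k].
Proof.
apply: uniq_perm; first by rewrite filter_uniq ?uniq_mis.
  rewrite map_inj_uniq; last exact: incr_inj.
  by case: k => // k; exact: uniq_mis.
move=> a; rewrite mem_filter mem_mis_lt; apply/andP/mapP => [[aj ak]|[b]].
  by exists (decr a j); rewrite ?decrK // mem_mis_lt -ltnS -(mabs_incr _ j) decrK.
by rewrite mem_mis_lt => bk ->; rewrite ffunE eqxx addn1 mabs_incr.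
Qed.

(** The Taylor remainder of [g (mi0 d)] at the origin, with [g a] in the role of its derivative of
    multi-index [a]. *)
Definition taylor_rem k (g : mi d -> 'rV[R]_d -> R) x : R :=
  g (mi0 d) x - \sum_(a <- mis_lt k) tmono a x * g a 0.

Lemma tmono0 a : tmono a 0 = (a == mi0 d)%:R.
Proof.
rewrite tmonoE; have [->|an0] := eqVneq a (mi0 d).
  by rewrite big1 // => i _; rewrite ffunE expr0 fact0 divr1.
have [i ai] : exists i, a i != 0%N.
  apply/existsP; rewrite -negb_forall; apply: contra an0 => /forallP H.
  by apply/eqP/ffunP => i; rewrite ffunE; apply/eqP.
by rewrite (bigD1 i) //= mxE expr0n (negPf ai) !mul0r.
Qed.

Lemma taylor_rem0 k g : taylor_rem k.+1 g 0 = 0.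
Proof.
rewrite /taylor_rem (bigD1_seq (mi0 d)) ?mem_mis ?mabs0 ?uniq_mis //=.
rewrite tmono0 eqxx mul1r big1 ?addr0 ?subrr // => a /negPf an0.
by rewrite tmono0 an0 mul0r.
Qed.

Lemma is_derive_taylor_rem k (g : mi d -> 'rV[R]_d -> R) j x :
  is_derive x (delta_mx 0 j) (g (mi0 d)) (g (incr (mi0 d) j) x) ->
  is_derive x (delta_mx 0 j) (taylor_rem k.+1 g) (taylor_rem k (fun a => g (incr a j)) x).
Proof.
move=> gj; apply: is_deriveB.
(* Differentiation kills the terms with [a j = 0]; the others are reindexed by [a = incr b j]. *)
have -> : \sum_(a <- mis_lt k) tmono a x * g (incr a j) 0 =
    \sum_(a <- mis_lt k.+1) ((a j != 0%N)%:R * tmono (decr a j) x * g a 0).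
  rewrite [RHS](bigID (fun a : mi d => a j != 0%N)) /= [X in _ + X]big1 ?addr0; last first.
    by move=> a /negPf ->; rewrite !mul0r.
  rewrite -[RHS]big_filter (perm_big _ (perm_mis_lt k j)) big_map.
  by apply: eq_bigr => a _; rewrite incrK ffunE eqxx addn1 mul1r.
apply: is_derive_bigsum => a _.
apply: is_derive_eq (is_deriveM (is_derive_tmono a x j) (is_derive_cst (g a 0) _ _)) _.
by rewrite scaler0 add0r /GRing.scale /= mulrC.
Qed.

(** Induction on [k]: the partial derivatives of the remainder are remainders of shifted families of
    order one less, the remainder vanishes at 0, and [mean_value_box] contributes the factor
    [d |x|]. *)
Lemma taylor_rem_le k (g : mi d -> 'rV[R]_d -> R) (r M : R) :
  (forall a j x, (mabs a < k)%N -> `|x| < r ->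
     is_derive x (delta_mx 0 j) (g a) (g (incr a j) x)) ->
  (forall a x, mabs a = k -> `|x| < r -> `|g a x| <= M) ->
  forall x, `|x| < r -> `|taylor_rem k g x| <= d%:R ^+ k * M * `|x| ^+ k.
Proof.
elim: k g => [|k IH] g gd gM x xr.
  by rewrite /taylor_rem big_nil subr0 expr0 mul1r mulr1 gM ?mabs0.
have := @mean_value_box (taylor_rem k.+1 g)
  (fun j => taylor_rem k (fun a => g (incr a j))) x (d%:R ^+ k * M * `|x| ^+ k).
rewrite taylor_rem0 subr0 exprS !mulrA => H.
rewrite [`|x| ^+ k.+1]exprSr mulrA; apply: H => z j zx.
  by apply: is_derive_taylor_rem; apply: gd; rewrite ?mabs0 // (le_lt_trans zx).
have zr := le_lt_trans zx xr.
apply: (le_trans (IH _ _ _ z zr)).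
- by move=> a i y ak yr; rewrite incrC; apply: gd; rewrite ?mabs_incr.
- by move=> a y ak yr; apply: gM; rewrite ?mabs_incr ?ak.
(* The index [j] provides a multi-index of degree [k.+1], on which the bound [gM] forces [M] to be
   nonnegative. *)
- have M0 : 0 <= d%:R ^+ k * M.
    have [a ak] : exists a : mi d, mabs a = k.+1.
      exists (iter k.+1 (fun a => incr a j) (mi0 d)).
      by elim: k.+1 => [|l IHl]; rewrite ?mabs0 //= mabs_incr IHl.
    by rewrite mulr_ge0 ?exprn_ge0 // (le_trans _ (gM a z ak zr)).
  by rewrite ler_wpM2l // lerXn2r ?nnegrE.
Qed.

End Taylor.

(** * Two-sided Taylor expansion of the kernel *)

Lemma Kder0 (R : realType) d (K : 'rV[R]_d -> 'rV[R]_d -> R) : Kder (mi0 d) (mi0 d) K = K.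
Proof.
rewrite /Kder; suff -> : dseq (mi0 d) (mi0 d) = [::] by [].
apply/nilP; rewrite /nilp /dseq size_cat !size_flatten /shape -!map_comp !sumnE !big_map.
by rewrite !big1 // => i _; rewrite /= size_nseq ffunE.
Qed.

Lemma mono_scale (R : realType) d (c : R) (x : 'rV[R]_d) a :
  mono (c *: x) a = c ^+ mabs a * mono x a.
Proof.
rewrite /mono /mabs -prodrXr -big_split /=.
by apply: eq_bigr => i _; rewrite mxE exprMn.
Qed.

Section KernelExpansion.
Variables (R : realType) (d k : nat) (Omega : set 'rV[R]_d).
Variable K : 'rV[R]_d -> 'rV[R]_d -> R.
Hypotheses (openO : open Omega) (O0 : Omega 0) (K_smooth : Cmm k.+1 Omega K).

Let G a b := Kder a b K.

Definition rem_l b x := taylor_rem k.+1 (fun a z => G a b z 0) x.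
Definition rem_r a y := taylor_rem k.+1 (fun b z => G a b 0 z) y.
Definition rem_lr x y :=
  taylor_rem k.+1 (fun a z => taylor_rem k.+1 (fun b t => G a b z t) y) x.

Lemma kernel_taylor x y :
  K x y = \sum_(a <- mis d k) \sum_(b <- mis d k)
            tmono a x * G a b 0 0 * tmono b y
    + \sum_(a <- mis d k) tmono a x * rem_r a y
    + \sum_(b <- mis d k) rem_l b x * tmono b y + rem_lr x y.
Proof.
rewrite -[K in LHS]Kder0.
(* Expansion in [y] with [x] fixed, whose remainder is itself expanded in [x]; the coefficients
   [G (mi0 d) b x 0] are expanded in [x] next. *)
have -> : Kder (mi0 d) (mi0 d) K x y = rem_lr x y
    + \sum_(a <- mis d k) tmono a x * rem_r a y
    + \sum_(b <- mis d k) G (mi0 d) b x 0 * tmono b y.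
  rewrite /rem_lr [taylor_rem _ _ x]/taylor_rem subrK /taylor_rem.
  by under [X in _ + X]eq_bigr do rewrite mulrC; rewrite subrK.
have E b : G (mi0 d) b x 0 = rem_l b x + \sum_(a <- mis d k) tmono a x * G a b 0 0.
  by rewrite /rem_l /taylor_rem subrK.
under [X in _ + X = _]eq_bigr do rewrite E mulrDl mulr_suml.
rewrite big_split /= exchange_big /=; ring.
Qed.

Lemma rem_le : exists r C : R, [/\ 0 < r, 0 <= C &
  forall x y a b, `|x| < r -> `|y| < r -> (mabs a <= k)%N -> (mabs b <= k)%N ->
  [/\ `|rem_l b x| <= C * `|x| ^+ k.+1, `|rem_r a y| <= C * `|y| ^+ k.+1
    & `|rem_lr x y| <= C * `|x| ^+ k.+1 * `|y| ^+ k.+1]].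
Proof.
have [r [M [r0 M0 rO GM]]] := Kder_bounded openO K_smooth O0.
pose c := d%:R ^+ k.+1 : R; have c0 : 0 <= c by rewrite exprn_ge0.
have rr a y z : (mabs a <= k.+1)%N -> `|y| < r -> `|z| < r ->
    `|taylor_rem k.+1 (fun b t => G a b z t) y| <= c * M * `|y| ^+ k.+1.
  move=> ak yr zr; apply: taylor_rem_le yr => [b j t bk tr|b t bk tr].
    by apply: (Kder_is_derive_r openO K_smooth) => //; exact: rO.
  by apply: GM; rewrite ?bk.
have zr : `|0 : 'rV[R]_d| < r by rewrite normr0.
(* [c * M] serves the one-sided remainders, [c * (c * M)] the two-sided one. *)
exists r, (c * M + c * (c * M)); split => //; first by rewrite !(addr_ge0, mulr_ge0).
move=> x y a b xr yr ak bk; split.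
- apply: (@le_trans _ _ (c * M * `|x| ^+ k.+1)).
    apply: taylor_rem_le xr => [a' j t a'k tr|a' t a'k tr].
      by apply: (Kder_is_derive_l openO K_smooth) => //; [exact: leqW|exact: rO].
    by apply: GM; rewrite ?a'k // leqW.
  by rewrite ler_wpM2r ?exprn_ge0 // lerDl !mulr_ge0.
- apply: (le_trans (rr _ _ _ (leqW ak) yr zr)).
  by rewrite ler_wpM2r ?exprn_ge0 // lerDl !mulr_ge0.
(* The bound in [x] is applied to the family of remainders in [y], whose members of order [k.+1] are
   bounded by [rr]. *)
- apply: (@le_trans _ _ (c * (c * M * `|y| ^+ k.+1) * `|x| ^+ k.+1)).
    apply: taylor_rem_le xr => [a' j t a'k tr|a' t a'k tr]; last by apply: rr => //; rewrite a'k.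
    apply: is_deriveB; first by apply: (Kder_is_derive_l openO K_smooth); rewrite ?mabs0 //; exact: rO.
    apply: is_derive_bigsum => b'; rewrite mem_mis => b'k.
    have H : is_derive t (delta_mx 0 j) (fun z => G a' b' z 0) (G (incr a' j) b' t 0).
      by apply: (Kder_is_derive_l openO K_smooth) => //; [exact: leqW|exact: rO].
    exact: is_deriveZ.
  rewrite [leRHS]mulrAC !mulrA ler_wpM2r ?exprn_ge0 // ler_wpM2r ?exprn_ge0 //.
  by rewrite -mulrA lerDr !mulr_ge0.
Qed.

End KernelExpansion.

(** * Orders of vanishing at 0 *)

Section BigO.
Variable R : realType.
Implicit Types (f g : R -> R) (c : R).

(** The neighbourhood is punctured because remainders get divided by powers of [eps]. *)
Definition big_O (n : nat) f :=
  exists C : R, \forall eps \near (0 : R)^', `|f eps| <= C * `|eps| ^+ n.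

Lemma big_OP n f : big_O n f -> exists2 C : R, 0 <= C &
  \forall eps \near (0 : R)^', `|f eps| <= C * `|eps| ^+ n.
Proof.
move=> [C fC]; exists `|C| => //; near=> eps.
apply: (@le_trans _ _ (C * `|eps| ^+ n)); first by near: eps.
by rewrite ler_wpM2r ?exprn_ge0 // ler_norm.
Unshelve. all: by end_near.
Qed.

Lemma big_O_eq n f g : f =1 g -> big_O n f -> big_O n g.
Proof. by move=> /funext ->. Qed.

Lemma big_O_cst c : big_O 0 (fun=> c).
Proof. by exists `|c|; near=> eps; rewrite expr0 mulr1. Unshelve. all: by end_near. Qed.

Lemma big_O0 n : big_O n (fun=> 0).
Proof. by exists 0; near=> eps; rewrite normr0 mul0r. Unshelve. all: by end_near. Qed.

Lemma big_O_X n : big_O n (fun eps => eps ^+ n).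
Proof. by exists 1; near=> eps; rewrite mul1r normrX. Unshelve. all: by end_near. Qed.

Lemma big_OD n f g : big_O n f -> big_O n g -> big_O n (fun eps => f eps + g eps).
Proof.
move=> [C fC] [C' gC]; exists (C + C'); near=> eps.
rewrite mulrDl (le_trans (ler_normD _ _)) // lerD //; near: eps; assumption.
Unshelve. all: by end_near.
Qed.

Lemma big_OM n m f g : big_O n f -> big_O m g ->
  big_O (n + m) (fun eps => f eps * g eps).
Proof.
move=> /big_OP[C C0 fC] /big_OP[C' C'0 gC]; exists (C * C'); near=> eps.
rewrite exprD mulrACA normrM ler_pM //; near: eps; assumption.
Unshelve. all: by end_near.
Qed.

Lemma big_O_le n m f : (m <= n)%N -> big_O n f -> big_O m f.
Proof.
move=> mn /big_OP[C C0 fC]; exists C; near=> eps.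
apply: (@le_trans _ _ (C * `|eps| ^+ n)); first by near: eps.
rewrite ler_wpM2l // ler_wiXn2l //.
by near: eps; exact: dnbhs0_le.
Unshelve. all: by end_near.
Qed.

Lemma big_O_sum n (I : Type) (s : seq I) (P : pred I) (F : I -> R -> R) :
  (forall i, P i -> big_O n (F i)) -> big_O n (fun eps => \sum_(i <- s | P i) F i eps).
Proof.
move=> H; elim: s => [|i s IH].
  by apply: big_O_eq (big_O0 n) => eps; rewrite big_nil.
have [Pi|nPi] := boolP (P i).
  by apply: big_O_eq (big_OD (H _ Pi) IH) => eps; rewrite big_cons Pi.
by apply: big_O_eq IH => eps; rewrite big_cons (negPf nPi).
Qed.

(** Convergence to [c] with error [O(eps)], the form of the limits in the determinant expansions. *)
Definition tends1 f c := big_O 1 (fun eps => f eps - c).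

Lemma tends1_cst c : tends1 (fun=> c) c.
Proof. by apply: big_O_eq (big_O0 1) => eps; rewrite subrr. Qed.

Lemma tends1_O f c : tends1 f c -> big_O 0 f.
Proof.
move=> /(big_O_le (leq0n 1))/big_OD/(_ (big_O_cst c)).
by apply: big_O_eq => eps; rewrite subrK.
Qed.

Lemma tends1D f g a c : tends1 f a -> tends1 g c -> tends1 (fun eps => f eps + g eps) (a + c).
Proof.
by move=> fa gc; apply: big_O_eq (big_OD fa gc) => eps; rewrite opprD addrACA.
Qed.

Lemma tends1M f g a c : tends1 f a -> tends1 g c -> tends1 (fun eps => f eps * g eps) (a * c).
Proof.
move=> fa gc; have fO := tends1_O fa.
apply: big_O_eq (big_OD (big_OM fO gc) (big_OM (big_O_cst c) fa)) => eps; ring.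
Qed.

Lemma tends1_sum (I : Type) (s : seq I) (P : pred I) (F : I -> R -> R) (c : I -> R) :
  (forall i, P i -> tends1 (F i) (c i)) ->
  tends1 (fun eps => \sum_(i <- s | P i) F i eps) (\sum_(i <- s | P i) c i).
Proof.
move=> /(big_O_sum s); apply: big_O_eq => eps; exact: sumrB.
Qed.

Lemma tends1_prod (I : Type) (s : seq I) (F : I -> R -> R) (c : I -> R) :
  (forall i, tends1 (F i) (c i)) ->
  tends1 (fun eps => \prod_(i <- s) F i eps) (\prod_(i <- s) c i).
Proof.
move=> H; elim: s => [|i s IH].
  by rewrite big_nil; apply: big_O_eq (tends1_cst 1) => eps; rewrite big_nil.
rewrite big_cons; apply: big_O_eq (tends1M (H i) IH) => eps.
by rewrite big_cons.
Qed.

Definition big_O_mx n p q (A : R -> 'M[R]_(p, q)) :=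
  forall i j, big_O n (fun eps => A eps i j).

Definition tends1_mx p q (A : R -> 'M[R]_(p, q)) (B : 'M[R]_(p, q)) :=
  forall i j, tends1 (fun eps => A eps i j) (B i j).

Lemma tends1_mx0 p q (A : R -> 'M[R]_(p, q)) : big_O_mx 1 A -> tends1_mx A 0.
Proof. by move=> AO i j; apply: big_O_eq (AO i j) => eps; rewrite mxE subr0. Qed.

Lemma tends1_mx_O p q (A : R -> 'M[R]_(p, q)) B : tends1_mx A B -> big_O_mx 0 A.
Proof. by move=> AB i j; exact: tends1_O (AB i j). Qed.

Lemma tends1_mx_cst p q (B : 'M[R]_(p, q)) : tends1_mx (fun=> B) B.
Proof. by move=> i j; exact: tends1_cst. Qed.

Lemma tends1_mxD p q (A A' : R -> 'M[R]_(p, q)) B B' : tends1_mx A B ->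
  tends1_mx A' B' -> tends1_mx (fun eps => A eps + A' eps) (B + B').
Proof.
move=> AB AB' i j; apply: big_O_eq (tends1D (AB i j) (AB' i j)) => eps.
by rewrite !mxE.
Qed.

Lemma tends1_mxM p q r (A : R -> 'M[R]_(p, q)) (A' : R -> 'M[R]_(q, r)) B B' :
  tends1_mx A B -> tends1_mx A' B' -> tends1_mx (fun eps => A eps *m A' eps) (B *m B').
Proof.
move=> AB AB' i j.
apply: big_O_eq (tends1_sum (index_enum 'I_q) (P := xpredT)
  (fun l _ => tends1M (AB i l) (AB' l j))) => eps.
by rewrite !mxE.
Qed.

Lemma tends1_mx_tr p q (A : R -> 'M[R]_(p, q)) B :
  tends1_mx A B -> tends1_mx (fun eps => (A eps)^T) B^T.
Proof. by move=> AB i j; apply: big_O_eq (AB j i) => eps; rewrite !mxE. Qed.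

Lemma big_O_mxM n m p q r (A : R -> 'M[R]_(p, q)) (B : R -> 'M[R]_(q, r)) :
  big_O_mx n A -> big_O_mx m B -> big_O_mx (n + m) (fun eps => A eps *m B eps).
Proof.
move=> AO BO i j.
apply: big_O_eq (big_O_sum (index_enum 'I_q) (P := xpredT)
  (fun l _ => big_OM (AO i l) (BO l j))) => eps.
by rewrite !mxE.
Qed.

Lemma big_O_mx_tr n p q (A : R -> 'M[R]_(p, q)) :
  big_O_mx n A -> big_O_mx n (fun eps => (A eps)^T).
Proof. by move=> AO i j; apply: big_O_eq (AO j i) => eps; rewrite mxE. Qed.

(** By the Leibniz formula the determinant is a polynomial in the entries. *)
Lemma tends1_det n (A : R -> 'M[R]_n) B :
  tends1_mx A B -> tends1 (fun eps => \det (A eps)) (\det B).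
Proof.
move=> AB; apply: tends1_sum => s _.
by apply: tends1M (tends1_cst _) _; exact: tends1_prod.
Qed.

Lemma eps_expandP f m c :
  (exists2 g, tends1 g c & \forall eps \near (0 : R)^', f eps = eps ^+ m * g eps) ->
  eps_expand f m c.
Proof.
move=> [g [C gC] fg].
have : \forall eps \near (0 : R)^', `|f eps - eps ^+ m * c| <= C * `|eps| ^+ m.+1.
  near=> eps; have -> : f eps = eps ^+ m * g eps by near: eps.
  rewrite -mulrBr normrM exprS mulrA mulrC -normrX ler_wpM2r //.
  by rewrite -[`|eps|]expr1; near: eps.
move=> /nbhs_ballP[delta /= delta0 H]; exists C, delta; split => // eps /andP[e0 ed].
apply: H; last by rewrite -normr_gt0.
by rewrite -ball_normE /ball_ /= sub0r normrN.
Unshelve. all: by end_near.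
Qed.

End BigO.

(** * Determinants in the flat limit *)

Section FlatLimit.
Variables (R : realType) (d k n : nat) (Omega : set 'rV[R]_d).
Variables (K : 'rV[R]_d -> 'rV[R]_d -> R) (e : nat -> mi d) (X : 'I_n -> 'rV[R]_d).
Hypotheses (openO : open Omega) (O0 : Omega 0) (K_smooth : Cmm k.+1 Omega K).
Hypothesis (e_graded : graded_enum k e).

Let N := NP d k.
Let scaledX (eps : R) i := eps *: X i.

Lemma mfact_neq0 (a : mi d) : (mfact a)%:R != 0 :> R.
Proof. by rewrite pnatr_eq0 -lt0n prodn_gt0 // => i; exact: fact_gt0. Qed.

Lemma near_scale_lt (r : R) : 0 < r -> \forall eps \near (0 : R)^', forall i, `|scaledX eps i| < r.
Proof.
move=> r0; pose B := \sum_i `|X i| + 1.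
have B0 : 0 < B by rewrite ltr_wpDl ?sumr_ge0.
near=> eps => i; rewrite normrZ (@le_lt_trans _ _ (`|eps| * B)) //.
  by rewrite ler_wpM2l // /B (bigD1 i) //= -addrA lerDl addr_ge0 ?sumr_ge0.
rewrite -ltr_pdivlMr //; near: eps; apply: dnbhs0_lt; exact: divr_gt0.
Unshelve. all: by end_near.
Qed.

Lemma Keps_expand : exists (W1 : R -> 'M[R]_(N, n)) (W2 : R -> 'M[R]_(n, N)) (W3 : R -> 'M[R]_n),
  [/\ big_O_mx 0 W1, big_O_mx 0 W2, big_O_mx 0 W3 &
   forall eps, eps != 0 -> let V := Vmx e (scaledX eps) N in
    Keps X K eps = V *m Wr k e K *m V^T + eps ^+ k.+1 *: (V *m W1 eps + W2 eps *m V^T)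
      + eps ^+ (2 * k.+1) *: W3 eps].
Proof.
have [r [C [r0 C0 remC]]] := rem_le openO O0 K_smooth.
have ek (a : 'I_N) : (mabs (e a) <= k)%N by have [_ + _ _] := e_graded; exact.
(* The remainders divided by their order in [eps]. The factorials that turn [tmono] into [mono] go
   into [W1] and [W2]; those of the main term are in [Wr]. *)
exists (fun eps => \matrix_(a, j) (rem_r k K (e a) (scaledX eps j) / (mfact (e a))%:R / eps ^+ k.+1)),
  (fun eps => \matrix_(i, b) (rem_l k K (e b) (scaledX eps i) / (mfact (e b))%:R / eps ^+ k.+1)),
  (fun eps => \matrix_(i, j) (rem_lr k K (scaledX eps i) (scaledX eps j) / eps ^+ (2 * k.+1))).
split.
- move=> a j; exists (C * `|X j| ^+ k.+1 / (mfact (e a))%:R); near=> eps.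
  have e0 : eps != 0 by near: eps; exact: nbhs_dnbhs_neq.
  have er : forall i, `|scaledX eps i| < r by near: eps; exact: near_scale_lt.
  rewrite mxE expr0 mulr1 !normrM !normfV normrX ler_pdivrMr ?exprn_gt0 ?normr_gt0 //.
  rewrite normr_nat [leRHS]mulrAC ler_wpM2r ?invr_ge0 // -mulrA -exprMn.
  have [_ + _] := remC (scaledX eps j) (scaledX eps j) (e a) (e a) (er j) (er j) (ek a) (ek a).
  by rewrite normrZ mulrC [`|X j| * _]mulrC mulrC.
- move=> i b; exists (C * `|X i| ^+ k.+1 / (mfact (e b))%:R); near=> eps.
  have e0 : eps != 0 by near: eps; exact: nbhs_dnbhs_neq.
  have er : forall i, `|scaledX eps i| < r by near: eps; exact: near_scale_lt.
  rewrite mxE expr0 mulr1 !normrM !normfV normrX ler_pdivrMr ?exprn_gt0 ?normr_gt0 //.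
  rewrite normr_nat [leRHS]mulrAC ler_wpM2r ?invr_ge0 // -mulrA -exprMn.
  have [+ _ _] := remC (scaledX eps i) (scaledX eps i) (e b) (e b) (er i) (er i) (ek b) (ek b).
  by rewrite normrZ mulrC [`|X i| * _]mulrC mulrC.
- move=> i j; exists (C * `|X i| ^+ k.+1 * `|X j| ^+ k.+1); near=> eps.
  have e0 : eps != 0 by near: eps; exact: nbhs_dnbhs_neq.
  have er : forall i, `|scaledX eps i| < r by near: eps; exact: near_scale_lt.
  rewrite mxE expr0 mulr1 !normrM !normfV normrX ler_pdivrMr ?exprn_gt0 ?normr_gt0 //.
  have [|| _ _] := remC (scaledX eps i) (scaledX eps j) (mi0 d) (mi0 d) (er i) (er j);
    rewrite ?mabs0 //.
  rewrite !normrZ !exprMn => /le_trans; apply.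
  by rewrite mul2n -addnn exprD le_eqVlt; apply/orP; left; apply/eqP; ring.
move=> eps e0 V; apply/matrixP => i j.
have e0k l : eps ^+ l != 0 by rewrite expf_neq0.
rewrite !mxE (kernel_taylor k K (scaledX eps i) (scaledX eps j)).
rewrite [eps ^+ (2 * k.+1) * _]mulrC divfK //; congr (_ + _).
rewrite mulrDr addrA; congr (_ + _ + _).
- rewrite (big_graded e_graded); under eq_bigr do rewrite (big_graded e_graded).
  rewrite exchange_big; apply: eq_bigr => b _; rewrite !mxE mulr_suml.
  by apply: eq_bigr => a _; rewrite !mxE /tmono invfM; ring.
- rewrite (big_graded e_graded) mulr_sumr; apply: eq_bigr => a _; rewrite !mxE /tmono.
  by field; rewrite mfact_neq0 expf_neq0.
- rewrite (big_graded e_graded) mulr_sumr; apply: eq_bigr => b _; rewrite !mxE /tmono.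
  by field; rewrite mfact_neq0 expf_neq0.
Unshelve. all: by end_near.
Qed.

Hypothesis nN : (n <= N)%N.
Variable P : 'M[R]_n.
Hypothesis P_graded : forall (i : 'I_n) (j : 'I_N),
  (mabs (e j) < mabs (e i))%N -> (P *m Vmx e X N) i j = 0.

(** The limit of [P] times the monomial matrix at the points [eps x_i], once row [i] is divided by
    [eps ^ |e i|]: lower degrees vanish by [P_graded], higher degrees keep a positive power of
    [eps]. *)
Definition leading_block : 'M[R]_(n, N) := \matrix_(i, j)
  if mabs (e j) == mabs (e i) then (P *m Vmx e X N) i j else 0.

(* Dividing row [i] of [P *m Vmx e (eps X)] by [eps ^+ |e i|] leaves only
   nonnegative powers of [eps], and row [i] of [eps ^+ k.+1 *: P] still tends to 0. *)
Lemma det_Keps_graded : eps_expand (fun eps => \det P ^+ 2 * \det (Keps X K eps))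
  (2 * \sum_(i < n) mabs (e i)) (\det (leading_block *m Wr k e K *m leading_block^T)).
Proof.
have [W1 [W2 [W3 [W1O W2O W3O KE]]]] := Keps_expand.
have ik (i : 'I_n) : (mabs (e i) <= k)%N.
  by have [_ + _ _] := e_graded; apply; exact: leq_trans (ltn_ord i) nN.
pose A eps : 'M[R]_(n, N) := \matrix_(i, j)
  ((P *m Vmx e X N) i j * eps ^+ (mabs (e j) - mabs (e i))).
pose Z eps : 'M[R]_n := \matrix_(i, j) (P i j * eps ^+ (k.+1 - mabs (e i))).
pose D eps : 'M[R]_n := diag_mx (\row_i (eps ^+ mabs (e i))).
have AL : tends1_mx A leading_block.
  move=> i j; rewrite mxE; have [ij|ij|ij] := ltngtP (mabs (e j)) (mabs (e i)).
  - apply: big_O_eq (big_O0 _ 1) => eps.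
    by rewrite mxE P_graded // mul0r subr0.
  - have := big_OM (big_O_cst ((P *m Vmx e X N) i j)) (big_O_X R (mabs (e j) - mabs (e i))).
    move=> /(@big_O_le _ _ 1); rewrite add0n subn_gt0 => /(_ ij).
    by apply: big_O_eq => eps; rewrite [in RHS]mxE subr0.
  - apply: big_O_eq (big_O0 _ 1) => eps.
    by rewrite [in RHS]mxE ij subnn expr0 mulr1 subrr.
have ZO : big_O_mx 1 Z.
  move=> i j; have := big_OM (big_O_cst (P i j)) (big_O_X R (k.+1 - mabs (e i))).
  move=> /(@big_O_le _ _ 1); rewrite add0n subn_gt0 ltnS => /(_ (ik i)).
  by apply: big_O_eq => eps; rewrite mxE.
pose H eps := A eps *m Wr k e K *m (A eps)^T + (A eps *m W1 eps *m (Z eps)^T +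
  (Z eps *m W2 eps *m (A eps)^T + Z eps *m W3 eps *m (Z eps)^T)).
have HL : tends1_mx H (leading_block *m Wr k e K *m leading_block^T).
  have AO := tends1_mx_O AL; have AtO := big_O_mx_tr AO; have ZtO := big_O_mx_tr ZO.
  rewrite -[X in tends1_mx _ X]addr0 -[X in _ + X]addr0 -[X in _ + (_ + X)]addr0.
  apply: tends1_mxD.
    by apply: tends1_mxM (tends1_mxM AL (tends1_mx_cst _)) (tends1_mx_tr AL).
  apply: tends1_mxD; first exact/tends1_mx0/(big_O_mxM (big_O_mxM AO W1O) ZtO).
  apply: tends1_mxD; first exact/tends1_mx0/(big_O_mxM (big_O_mxM ZO W2O) AtO).
  apply: tends1_mx0 => i j; apply: (@big_O_le _ 2) => //.
  exact: (big_O_mxM (big_O_mxM ZO W3O) ZtO).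
apply: eps_expandP; exists (fun eps => \det (H eps)); first exact: tends1_det.
near=> eps; have e0 : eps != 0 by near: eps; exact: nbhs_dnbhs_neq.
have PV : P *m Vmx e (scaledX eps) N = D eps *m A eps.
  apply/matrixP => i j; rewrite mul_diag_mx !mxE mulrCA.
  have -> : \sum_l P i l * (Vmx e (scaledX eps) N) l j =
            (P *m Vmx e X N) i j * eps ^+ mabs (e j).
    rewrite mxE mulr_suml; apply: eq_bigr => l _.
    by rewrite !mxE mono_scale -mulrA [mono _ _ * _]mulrC.
  have [ij|ij] := ltnP (mabs (e j)) (mabs (e i)).
    by have := P_graded ij; rewrite mxE => ->; rewrite !mul0r.
  by rewrite mxE -exprD subnKC.
have PZ : eps ^+ k.+1 *: P = D eps *m Z eps.
  apply/matrixP => i j; rewrite mul_diag_mx !mxE mulrCA -exprD subnKC 1?mulrC //.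
  exact: leqW.
(* Under congruence by [P], each [P V(eps)] becomes [D A] and each [eps ^ (k+1) P] becomes [D Z], so
   [D] factors out on both sides. *)
have PK : P *m Keps X K eps *m P^T = D eps *m H eps *m (D eps)^T.
  rewrite KE // mulmxDr mulmxDr mulmxDl mulmxDl.
  have E1 : P *m (Vmx e (scaledX eps) N *m Wr k e K *m (Vmx e (scaledX eps) N)^T) *m P^T =
      D eps *m (A eps *m Wr k e K *m (A eps)^T) *m (D eps)^T.
    rewrite !mulmxA PV -[_ *m P^T]mulmxA -trmx_mul PV trmx_mul.
    by rewrite !mulmxA.
  have E2 : P *m (eps ^+ k.+1 *: (Vmx e (scaledX eps) N *m W1 eps + W2 eps *m (Vmx e (scaledX eps) N)^T)) *m P^T =
      D eps *m (A eps *m W1 eps *m (Z eps)^T + Z eps *m W2 eps *m (A eps)^T) *m (D eps)^T.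
    rewrite scalerDr mulmxDr mulmxDl mulmxDr mulmxDl; congr (_ + _).
      rewrite -scalemxAr -scalemxAl scalemxAr !mulmxA PV -linearZ /= PZ trmx_mul.
      by rewrite !mulmxA.
    rewrite -scalemxAr -scalemxAl !mulmxA -[_ *m P^T]mulmxA -trmx_mul PV.
    by rewrite !scalemxAl PZ trmx_mul !mulmxA.
  have E3 : P *m (eps ^+ (2 * k.+1) *: W3 eps) *m P^T =
      D eps *m (Z eps *m W3 eps *m (Z eps)^T) *m (D eps)^T.
    rewrite mul2n -addnn exprD -scalerA -scalemxAr scalemxAl PZ -scalemxAr -scalemxAl scalemxAr.
    by rewrite -linearZ /= PZ trmx_mul !mulmxA.
  rewrite E1 E2 E3 /H !mulmxDr !mulmxDl -!addrA //.
have := congr1 (fun M => \det M) PK; rewrite /= !det_mulmx !det_tr.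
have -> : \det (D eps) = eps ^+ (\sum_(i < n) mabs (e i)).
  by rewrite det_diag -prodrXr; apply: eq_bigr => i _; rewrite mxE.
rewrite mul2n -addnn exprD => E; rewrite expr2 -mulrA [X in _ * X]mulrC mulrA.
by rewrite E mulrAC.
Unshelve. all: by end_near.
Qed.

End FlatLimit.

Lemma det_upper_trig (R : comNzRingType) n (A : 'M[R]_n) :
  (forall i j : 'I_n, (j < i)%N -> A i j = 0) -> \det A = \prod_i A i i.
Proof.
move=> A0; rewrite -det_tr det_trig; first by apply: eq_bigr => i _; rewrite mxE.
by apply/is_trig_mxP => i j ij; rewrite mxE A0.
Qed.

(** From the factorisation $PA = LU$ with pivoting: $L^{-1}P$ is invertible and maps $A$ to the
    upper triangular $U$, also for singular $A$. *)
Lemma upper_trig_reduction (F : fieldType) n (A : 'M[F]_n) : exists2 P : 'M[F]_n,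
  \det P != 0 & forall i j : 'I_n, (j < i)%N -> (P *m A) i j = 0.
Proof.
case: n A => [|n] A; first by exists 1%:M; rewrite ?det1 ?oner_eq0 // => -[].
have := cormen_lup_correct A; have := cormen_lup_perm A.
have := cormen_lup_detL A; have := cormen_lup_upper A.
case: (cormen_lup A) => [[P L] U] /= U0 L1 Pp PA.
have Lu : L \in unitmx by rewrite unitmxE L1 unitr1.
have Pu : P \in unitmx by case/is_perm_mxP: Pp => s ->; exact: unitmx_perm.
exists (invmx L *m P).
  by rewrite -unitfE -unitmxE unitmx_mul unitmx_inv Lu.
by move=> i j ij; rewrite -mulmxA [P *m A]PA mulKmx // U0.
Qed.

Lemma eps_expandZ (R : realType) (f : R -> R) m (a c : R) : a != 0 ->
  eps_expand (fun eps => a * f eps) m (a * c) -> eps_expand f m c.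
Proof.
move=> a0 [C [delta [delta0 H]]]; exists (C / `|a|), delta; split => // eps /H.
by rewrite mulrCA -mulrBr normrM mulrAC ler_pdivlMr ?normr_gt0 // mulrC.
Qed.

(** * Determinant expansions for $n = \#\mathbb{P}_k$ and by orthogonal factorisation *)

Section DetExpansion.
Variables (R : realType) (d k : nat) (Omega : set 'rV[R]_d).
Variables (K : 'rV[R]_d -> 'rV[R]_d -> R) (e : nat -> mi d).
Hypotheses (openO : open Omega) (O0 : Omega 0) (K_smooth : Cmm k.+1 Omega K).
Hypothesis (e_graded : graded_enum k e).

Lemma graded_lt i j : (mabs (e j) < mabs (e i))%N -> (j < NP d k)%N -> (j < i)%N.
Proof.
have [_ _ _ e_mono] := e_graded.
by move=> + jN; rewrite !ltnNge; apply: contra => ij; exact: e_mono.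
Qed.

Lemma det_Keps_square (X : 'I_(NP d k) -> 'rV[R]_d) :
  eps_expand (fun eps => \det (Keps X K eps)) (2 * Mkd k d)
    (\det (Wr k e K) * \det (Vmx e X (NP d k)) ^+ 2).
Proof.
have [P P0 PV] := upper_trig_reduction (Vmx e X (NP d k)).
(* Along a graded order a column of smaller degree stands further left, so upper triangular implies
   block triangular by degree. *)
have PG (i j : 'I_(NP d k)) : (mabs (e j) < mabs (e i))%N ->
    (P *m Vmx e X (NP d k)) i j = 0.
  by move=> ij; apply: PV; exact: graded_lt ij (ltn_ord j).
have nn : (NP d k <= NP d k)%N by [].
have := @det_Keps_graded R d k (NP d k) Omega K e X openO O0 K_smooth e_graded nn P PG.
set B := leading_block _ _ _ _.
(* [B] and [P *m Vmx e X (NP d k)] are upper triangular with the same diagonal. *)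
have detB : \det B = \det P * \det (Vmx e X (NP d k)).
  rewrite -det_mulmx !det_upper_trig //; first by apply: eq_bigr => i _; rewrite mxE eqxx.
  by move=> i j ij; rewrite mxE; case: ifP => // _; rewrite PV.
rewrite graded_sum // !det_mulmx det_tr detB => H.
apply: (@eps_expandZ _ _ _ (\det P ^+ 2)); first by rewrite expf_neq0.
by move: H; rewrite (_ : _ * _ * _ = \det P ^+ 2 * (\det (Wr k e K) * \det (Vmx e X (NP d k)) ^+ 2)) //; ring.
Qed.

(** The omitted [NP d k - n] indices stand beyond the first [NP d k.-1] positions, hence have degree
    exactly [k]. *)
Lemma graded_sum_prefix n : (0 < k)%N -> (NP d k.-1 < n <= NP d k)%N ->
  (\sum_(i < n) mabs (e i) = Mkd k d - k * (NP d k - n))%N.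
Proof.
move=> k0 /andP[mn nN]; rewrite -(graded_sum e_graded).
rewrite -[X in (X - _)%N](big_mkord xpredT (fun i => mabs (e i))).
rewrite (big_cat_nat (n := n)) //= big_mkord [X in (_ + X)%N](eq_big_nat _ _ (F2 := fun=> k)).
  by rewrite sum_nat_const_nat mulnC addnK.
move=> i /andP[ni iN]; have [_ e_le _ _] := e_graded.
apply/eqP; rewrite eqn_leq e_le //= -(prednK k0) ltnNge (graded_leq e_graded) //.
  by rewrite -leqNgt ltnW // (leq_trans mn).
exact: leq_pred.
Qed.

(** With $P = Q^\top$ the leading block is [L *m Y] for a square [L] built from the entries of [Rt],
    and $\det(L)^2 = \det(R^\top R) = \det(V_{\le k-1}^\top V_{\le k-1})$. *)
Lemma det_Keps_rect n (X : 'I_n -> 'rV[R]_d) (Q : 'M[R]_n) (Rt : 'M[R]_(n, NP d k.-1)) :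
  (0 < k)%N -> (NP d k.-1 < n <= NP d k)%N -> Q *m Q^T = 1%:M ->
  (forall (i : 'I_n) (j : 'I_(NP d k.-1)), (j < i)%N -> Rt i j = 0) ->
  Vmx e X (NP d k.-1) = Q *m Rt ->
  let m := NP d k.-1 in
  let Y : 'M[R]_(n, NP d k) :=
    \matrix_(i < n, j < NP d k)
       (if (i < m)%N then (i == j :> nat)%:R
        else if (m <= j)%N then (Q^T *m Vmx e X (NP d k)) i j
        else 0) in
  eps_expand (fun eps => \det (Keps X K eps)) (2 * (Mkd k d - k * (NP d k - n)))
    (\det (Y *m Wr k e K *m Y^T) * \det ((Vmx e X m)^T *m Vmx e X m)).
Proof.
move=> k0 nk QQ Rt0 VQR m Y; have /andP[mn nN] := nk.
have QtQ : Q^T *m Q = 1%:M by exact: mulmx1C.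
have detQ : \det Q^T ^+ 2 = 1 by rewrite expr2 -{1}det_tr trmxK -det_mulmx QQ det1.
have [_ e_le _ _] := e_graded.
have QV i (j : 'I_(NP d k)) (jm : (j < m)%N) :
    (Q^T *m Vmx e X (NP d k)) i j = Rt i (Ordinal jm).
  have -> : Rt = Q^T *m Vmx e X m by rewrite VQR mulmxA QtQ mul1mx.
  by rewrite !mxE; apply: eq_bigr => l _; rewrite !mxE.
have degm i : (i < NP d k)%N -> (i < m)%N = (mabs (e i) < k)%N.
  by move=> iN; rewrite -[in RHS](prednK k0) ltnS (graded_leq e_graded) ?leq_pred.
have PG (i : 'I_n) (j : 'I_(NP d k)) : (mabs (e j) < mabs (e i))%N ->
    (Q^T *m Vmx e X (NP d k)) i j = 0.
  move=> ji; have iN := leq_trans (ltn_ord i) nN.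
  (* A column of smaller degree than a row has degree below [k], so it belongs to $V_{\le k-1}$ and
     [Rt] gives its entries. *)
  have jm : (j < m)%N by rewrite degm // (leq_trans ji) // e_le.
  by rewrite (QV _ _ jm) Rt0 //=; exact: graded_lt ji _.
have := @det_Keps_graded R d k n Omega K e X openO O0 K_smooth e_graded nN Q^T PG.
set B := leading_block _ _ _ _; rewrite graded_sum_prefix //.
(* [Rt] on natural indices, 0 outside its range, so that matrices of sizes [n] and [m] can share its
   entries. *)
pose rt (i j : nat) : R := if insub i is Some i' then if insub j is Some j' then Rt i' j' else 0 else 0.
have rtE i j : rt (val i) (val j) = Rt i j by rewrite /rt !valK.
(* The degree-diagonal blocks of [Rt], completed by an identity on the rows of degree [k]. *)
pose L : 'M[R]_n := \matrix_(i, j) if (i < m)%N then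
   if (j < m)%N && (mabs (e j) == mabs (e i)) then rt i j else 0 else (i == j)%:R.
have BL : B = L *m Y.
  apply/matrixP => i j; rewrite [B i j]mxE [(L *m Y) i j]mxE.
  have iN := leq_trans (ltn_ord i) nN.
  have [im|mi] := ltnP i m; last first.
    rewrite (bigD1 i) //= big1 ?addr0 => [|l /negPf li]; last first.
      by rewrite [L i l]mxE ltnNge mi /= eq_sym li mul0r.
    rewrite [L i i]mxE [Y i j]mxE ltnNge mi /= eqxx mul1r.
    have -> : mabs (e i) = k.
      by apply/eqP; rewrite eqn_leq e_le //= leqNgt -degm // -leqNgt.
    by rewrite leqNgt degm // -leqNgt eqn_leq e_le.
  have [jm|mj] := ltnP j m.
    have jn : (j < n)%N by exact: leq_trans jm (ltnW mn).
    rewrite (bigD1 (Ordinal jn)) //= big1 ?addr0 => [|l lj]; last first.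
      rewrite [L i l]mxE im; case: ifP => [/andP[lm _]|_]; last by rewrite mul0r.
      rewrite [Y l j]mxE lm (_ : (l == j :> nat) = false) ?mulr0 //.
      by apply: contraNF lj => /eqP lj; apply/eqP/val_inj.
    rewrite [L i _]mxE [Y _ j]mxE im /= jm /= eqxx mulr1; case: ifP => // _.
    by rewrite (QV _ _ jm) -rtE.
  rewrite big1 => [|l _].
    by case: eqP => // ej; move: mj; rewrite leqNgt degm // ej -degm // im.
  rewrite [L i l]mxE im; case: ifP => [/andP[lm _]|_]; last by rewrite mul0r.
  by rewrite [Y l j]mxE lm (ltn_eqF (leq_trans lm mj)) mulr0.
have detL : \det L = \prod_(i < m) rt i i.
  rewrite det_upper_trig.
    under eq_bigr => i _ do rewrite mxE eqxx eqxx andbT.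
    rewrite -(big_mkord xpredT (fun i => if (i < m)%N then if (i < m)%N then rt i i else 0 else 1)).
    rewrite (big_cat_nat (n := m)) ?(ltnW mn) //= [X in _ * X]big_nat_cond [X in _ * X]big1; last first.
      by move=> i /andP[/andP[mi _] _]; rewrite ltnNge mi.
    by rewrite mulr1 big_mkord; apply: eq_bigr => i _; rewrite ltn_ord.
  move=> i j ji; rewrite mxE; case: ifP => im; last first.
    by rewrite (_ : (i == j) = false) //; apply: contraTF ji => /eqP ->; rewrite ltnn.
  case: ifP => // /andP[jm _].
  by rewrite -[nat_of_ord j]/(val (Ordinal jm)) rtE Rt0.
have -> : \det ((Vmx e X m)^T *m Vmx e X m) = \det L ^+ 2.
  (* [U] is the top square block of [Rt], whose remaining rows vanish; its diagonal is that of [L]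
     without the trailing ones. *)
  pose U : 'M[R]_m := \matrix_(i, j) rt i j.
  have detU : \det U = \det L.
    rewrite detL det_upper_trig; first by apply: eq_bigr => i _; rewrite mxE.
    move=> i j ji; rewrite mxE.
    have iN : (i < n)%N by exact: leq_trans (ltn_ord i) (ltnW mn).
    by rewrite -[nat_of_ord i]/(val (Ordinal iN)) rtE Rt0.
  rewrite VQR trmx_mul -mulmxA [Q^T *m _]mulmxA QtQ mul1mx.
  have -> : Rt^T *m Rt = U^T *m U.
    apply/matrixP => i j; rewrite !mxE.
    under eq_bigr => l _ do rewrite mxE -!rtE.
    under [RHS]eq_bigr => l _ do rewrite !mxE.
    rewrite -(big_mkord xpredT (fun l => rt l (val i) * rt l (val j))).
    rewrite (big_cat_nat (n := m)) ?(ltnW mn) //= [X in _ + X]big_nat_cond [X in _ + X]big1; last first.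
      move=> l /andP[/andP[ml ln] _].
      by rewrite -[l]/(val (Ordinal ln)) rtE Rt0 ?mul0r //= (leq_trans (ltn_ord i)).
    by rewrite addr0 big_mkord.
  by rewrite det_mulmx det_tr detU expr2.
have -> : \det (B *m Wr k e K *m B^T) = \det (Y *m Wr k e K *m Y^T) * \det L ^+ 2.
  rewrite BL trmx_mul -!mulmxA det_mulmx !mulmxA.
  by rewrite det_mulmx det_tr; ring.
by rewrite detQ => H; apply: (@eps_expandZ _ _ _ 1); rewrite ?oner_eq0 // mul1r.
Qed.

End DetExpansion.

(** * Eigenvalue groups *)

From mathcomp Require Import complex.

Lemma char_poly_conj (F : fieldType) n (P D : 'M[F]_n) : P \in unitmx ->
  char_poly (invmx P *m D *m P) = char_poly D.
Proof.
move=> Pu; rewrite /char_poly /char_poly_mx.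
have PP : map_mx (@polyC F) (invmx P) *m map_mx (@polyC F) P = 1%:M.
  by rewrite -map_mxM mulVmx // map_mx1.
have -> : 'X%:M - map_mx (@polyC F) (invmx P *m D *m P) =
    map_mx (@polyC F) (invmx P) *m ('X%:M - map_mx (@polyC F) D) *m map_mx (@polyC F) P.
  rewrite mulmxBr mulmxBl !map_mxM; congr (_ - _).
  by rewrite scalar_mxC -mulmxA PP mulmx1.
by rewrite !det_mulmx mulrAC -det_mulmx PP det1 mul1r.
Qed.

Lemma quad_row_gt0 (R : realType) n (u : 'rV[R]_n) : u != 0 -> 0 < (u *m u^T) 0 0.
Proof.
move=> u0; have [i ui] : exists i, u 0 i != 0.
  apply/existsP; rewrite -negb_forall; apply: contra u0 => /forallP H.
  by apply/eqP/rowP => i; rewrite mxE; apply/eqP.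
rewrite mxE (bigD1 i) //= mxE ltr_pwDl //.
  by rewrite -expr2 lt0r sqr_ge0 sqrf_eq0 ui.
by apply: sumr_ge0 => j _; rewrite mxE -expr2 sqr_ge0.
Qed.

(** A left eigenvector tests the form. Upper bounds on eigenvalues thereby become bounds on their
    absolute values. *)
Lemma psd_eig_ge0 (R : realType) n (A : 'M[R]_n) lam i :
  psdmx A -> eigs_noninc A lam -> 0 <= lam i.
Proof.
move=> [_ A0] [charA _].
have : eigenvalue A (lam i).
  rewrite eigenvalue_root_char charA rootE horner_prod (bigD1 i) //=.
  by rewrite !hornerE subrr mul0r.
move=> /eigenvalueP[v vA v0]; have := A0 v^T.
by rewrite trmxK vA -scalemxAl mxE pmulr_lge0 // quad_row_gt0.
Qed.

(** * Courant-Fischer bound through the complex spectral theorem *)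

Section CourantFischer.
Variables (R : realType) (n : nat).
Local Notation C := (complex R).
Local Notation toC := (map_mx (real_complex R)).
Local Notation adj M := (map_mx Num.conj M^T).

Lemma Re_mul_conj (z w : C) : Re (z * Num.conj w) = Re z * Re w + Im z * Im w.
Proof. by case: z w => [a b] [c d] /=; rewrite mulrN opprK. Qed.

Lemma Re_sum (I : Type) (s : seq I) (F : I -> C) :
  Re (\sum_(i <- s) F i) = \sum_(i <- s) Re (F i).
Proof.
by elim: s => [|i s IH]; rewrite ?big_nil // !big_cons -IH; case: (F i) (\sum_(_ <- _) _) => ? ? [].
Qed.

Lemma Im_sum (I : Type) (s : seq I) (F : I -> C) :
  Im (\sum_(i <- s) F i) = \sum_(i <- s) Im (F i).
Proof.
by elim: s => [|i s IH]; rewrite ?big_nil // !big_cons -IH; case: (F i) (\sum_(_ <- _) _) => ? ? [].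
Qed.

Lemma Re_mulr (z : C) (x : R) : Re (z * x%:C%C) = Re z * x.
Proof. by case: z => a b /=; rewrite mulr0 subr0. Qed.

Lemma Im_mulr (z : C) (x : R) : Im (z * x%:C%C) = Im z * x.
Proof. by case: z => a b /=; rewrite mulr0 add0r. Qed.

Lemma Re_mulmx p q (v : 'M[C]_(p, q)) r (A : 'M[R]_(q, r)) :
  map_mx (@Re R) (v *m toC A) = map_mx (@Re R) v *m A.
Proof.
by apply/matrixP => i j; rewrite !mxE Re_sum; apply: eq_bigr => l _; rewrite !mxE Re_mulr.
Qed.

Lemma Im_mulmx p q (v : 'M[C]_(p, q)) r (A : 'M[R]_(q, r)) :
  map_mx (@Im R) (v *m toC A) = map_mx (@Im R) v *m A.
Proof.
by apply/matrixP => i j; rewrite !mxE Im_sum; apply: eq_bigr => l _; rewrite !mxE Im_mulr.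
Qed.

(** Splitting into real and imaginary parts lets inequalities known for real rows be applied to
    complex ones. *)
Lemma Re_form p (v w : 'rV[C]_p) : Re ((v *m adj w) 0 0) =
  (map_mx (@Re R) v *m (map_mx (@Re R) w)^T) 0 0
    + (map_mx (@Im R) v *m (map_mx (@Im R) w)^T) 0 0.
Proof.
rewrite !mxE Re_sum -big_split; apply: eq_bigr => l _; rewrite !mxE; exact: Re_mul_conj.
Qed.

(** [lam] and the spectral diagonal are root lists of one characteristic polynomial, so they differ
    by a permutation [s]; permuting the rows of the unitary matrix puts the eigenvalues in the order
    of [lam]. *)
Lemma spectral_reindex (A : 'M[R]_n) lam : A^T = A -> eigs_noninc A lam ->
  exists2 P : 'M[C]_n, P *m adj P = 1%:M &
    P *m toC A *m adj P = diag_mx (\row_i (lam i)%:C%C).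
Proof.
move=> AT [charA _]; set B := toC A.
have BB : adj B = B.
  apply/matrixP => i j; rewrite !mxE -[in RHS]AT mxE; exact: conjc_real.
have Bn : B \is normalmx by apply/normalmxP; rewrite -[map_mx _ _]/(adj B) BB.
pose S := spectralmx B; pose D := spectral_diag B.
have Su : S \is unitarymx := spectral_unitarymx B.
have SS : S *m adj S = 1%:M by apply/unitarymxP.
have BE : B = invmx S *m diag_mx D *m S by apply/orthomx_spectralP.
have : char_poly B = char_poly (diag_mx D).
  by rewrite BE char_poly_conj // unitarymx_unit.
rewrite -map_char_poly charA rmorph_prod char_poly_trig ?diag_mx_is_trig //.
have -> : \prod_i map_poly (real_complex R) ('X - (lam i)%:P) =
    \prod_(x <- [tuple (lam i)%:C%C | i < n]) ('X - x%:P).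
  rewrite big_tuple; apply: eq_bigr => i _.
  by rewrite rmorphB /= map_polyX map_polyC tnth_mktuple.
have -> : \prod_(i < n) ('X - ((diag_mx D) i i)%:P) =
    \prod_(x <- [tuple D 0 i | i < n]) ('X - x%:P).
  by rewrite big_tuple; apply: eq_bigr => i _; rewrite tnth_mktuple mxE eqxx mulr1n.
move=> /prod_XsubC_eq/tuple_permP[s lamD].
have lamE i : (lam i)%:C%C = D 0 (s i).
  have := congr1 (fun t => nth 0 t i) lamD.
  by rewrite -!tnth_nth !tnth_mktuple.
have SBS : S *m B *m adj S = diag_mx D.
  by rewrite [in LHS]BE !mulmxA mulmxV ?unitarymx_unit // mul1mx -mulmxA SS mulmx1.
have adjrow : adj (row_perm s S) = col_perm s (adj S).
  by apply/matrixP => i j; rewrite !mxE.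
exists (row_perm s S); rewrite adjrow.
  rewrite row_permE col_permE !mulmxA -[_ *m S *m _]mulmxA SS mulmx1 -perm_mxM.
  by rewrite mulgV perm_mx1.
rewrite row_permE col_permE !mulmxA -[_ *m S *m B]mulmxA -[_ *m _ *m adj S]mulmxA SBS.
rewrite -row_permE -col_permE; apply/matrixP => i j; rewrite !mxE -lamE.
by rewrite (inj_eq perm_inj).
Qed.

(* Courant-Fischer: the span of the eigenvectors of [lam 0, ..., lam i] meets
   every subspace of codimension at most [i]. *)
Lemma eig_le (A : 'M[R]_n) lam m (V : 'M[R]_(n, m)) (c : R) (i : 'I_n) :
  A^T = A -> eigs_noninc A lam -> (m <= i)%N ->
  (forall u : 'rV[R]_n, u *m V = 0 -> (u *m A *m u^T) 0 0 <= c * (u *m u^T) 0 0) ->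
  lam i <= c.
Proof.
move=> AT Alam mi uc; have [P PP PAP] := spectral_reindex AT Alam.
(* [E] embeds the coefficients of combinations of the first [i.+1] eigenvectors. *)
pose E : 'M[C]_(i.+1, n) := \matrix_(a, b) (a == b :> nat)%:R.
have wid (a : 'I_i.+1) : (a < n)%N by exact: leq_trans (ltn_ord a) (ltn_ord i).
have EE (w : 'rV[C]_i.+1) (a : 'I_i.+1) : (w *m E) 0 (Ordinal (wid a)) = w 0 a.
  rewrite mxE (bigD1 a) //= big1 => [|b /negPf ba]; first by rewrite mxE eqxx mulr1 addr0.
  by rewrite mxE (_ : (_ == _) = false) ?mulr0.
have E0 (w : 'rV[C]_i.+1) (b : 'I_n) : (i < b)%N -> (w *m E) 0 b = 0.
  move=> ib; rewrite mxE big1 // => a _; rewrite mxE (_ : (_ == _) = false) ?mulr0 //.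
  by rewrite ltn_eqF // (leq_trans (ltn_ord a)).
(* There are [i.+1] unknowns and only [m <= i] equations. *)
have [w w0 wE] : exists2 w : 'rV[C]_i.+1, w != 0 & w *m (E *m P *m toC V) = 0.
  have : kermx (E *m P *m toC V) != 0.
    rewrite kermx_eq0 /row_free; apply/eqP => rk.
    by have := rank_leq_col (E *m P *m toC V); rewrite rk ltnNge mi.
  by move=> /rowV0Pn[w /sub_kermxP wk w0]; exists w.
pose z := w *m E; pose v := z *m P.
have adjM p q r (M1 : 'M[C]_(p, q)) (M2 : 'M[C]_(q, r)) : adj (M1 *m M2) = adj M2 *m adj M1.
  by rewrite trmx_mul map_mxM.
pose N b := Re (z 0 b) ^+ 2 + Im (z 0 b) ^+ 2.
have N0 b : 0 <= N b by rewrite addr_ge0 ?sqr_ge0.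
have zz b : Re (z 0 b * adj z b 0) = N b.
  by rewrite [adj z b 0]mxE [z^T _ _]mxE Re_mul_conj.
have zD b : (z *m diag_mx (\row_i (lam i)%:C%C)) 0 b = z 0 b * (lam b)%:C%C.
  by rewrite mul_mx_diag [LHS]mxE [(\row_i _) _ _]mxE.
have vv : Re ((v *m adj v) 0 0) = \sum_b N b.
  rewrite adjM mulmxA -[_ *m P *m _]mulmxA PP mulmx1 mxE Re_sum.
  by apply: eq_bigr => b _; exact: zz.
have vAv : Re ((v *m toC A *m adj v) 0 0) = \sum_b N b * lam b.
  rewrite adjM mulmxA -[z *m P *m _]mulmxA -[z *m _ *m _]mulmxA PAP mxE Re_sum.
  by apply: eq_bigr => b _; rewrite zD mulrAC Re_mulr zz.
have vV : v *m toC V = 0 by rewrite -wE !mulmxA.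
have vVR := Re_mulmx v V; have vVI := Im_mulmx v V.
(* The bound [uc] for the real and the imaginary part of [v], added up. *)
have : \sum_b N b * lam b <= c * \sum_b N b.
  rewrite -vAv -vv !Re_form Re_mulmx Im_mulmx mulrDr lerD //; apply: uc.
    by rewrite -vVR vV; apply/matrixP => ? ?; rewrite !mxE.
  by rewrite -vVI vV; apply/matrixP => ? ?; rewrite !mxE.
(* Coordinates up to [i] carry eigenvalues at least [lam i]; the later ones vanish. *)
have lamN : lam i * \sum_b N b <= \sum_b N b * lam b.
  rewrite mulr_sumr; apply: ler_sum => b _; have [bi|ib] := leqP b i.
    by rewrite mulrC ler_wpM2l //; case: Alam => _; exact.
  by rewrite /N /z E0 //= expr0n addr0 mulr0 mul0r.
move=> /(le_trans lamN); rewrite ler_pM2r //.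
have [a wa] : exists a, w 0 a != 0.
  apply/existsP; rewrite -negb_forall; apply: contra w0 => /forallP H.
  by apply/eqP/rowP => a; rewrite mxE; apply/eqP.
rewrite (bigD1 (Ordinal (wid a))) //= ltr_pwDl ?sumr_ge0 //.
rewrite lt_def N0 andbT /N /z EE paddr_eq0 ?sqr_ge0 // !sqrf_eq0.
by move: wa; rewrite eq_complex.
Qed.

End CourantFischer.

(** * Bounds on the groups of eigenvalues *)

Section EigenvalueGroups.
Variables (R : realType) (d k n : nat) (Omega : set 'rV[R]_d).
Variables (K : 'rV[R]_d -> 'rV[R]_d -> R) (e : nat -> mi d) (X : 'I_n -> 'rV[R]_d).
Hypotheses (openO : open Omega) (O0 : Omega 0) (K_smooth : Cmm k.+1 Omega K).
Hypothesis (e_graded : graded_enum k e).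

(** Each product $|u_iu_j|$ is at most $uu^\top$, so the sum of the absolute values of the entries
    bounds the form, uniformly in [u]. *)
Lemma quad_form_le (H : R -> 'M[R]_n) m : big_O_mx m H ->
  exists C : R, \forall eps \near (0 : R)^', forall u : 'rV[R]_n,
    (u *m H eps *m u^T) 0 0 <= C * `|eps| ^+ m * (u *m u^T) 0 0.
Proof.
move=> HO; have : big_O m (fun eps => \sum_i \sum_j `|H eps i j|).
  apply: big_O_sum => i _; apply: big_O_sum => j _.
  have [C HC] := HO i j; exists C; near=> eps; rewrite normr_id; near: eps; exact: HC.
move=> [C HC]; exists C; near=> eps => u.
have u_le i : `|u 0 i| ^+ 2 <= (u *m u^T) 0 0.
  rewrite mxE (bigD1 i) //= mxE -expr2 real_normK ?num_real // lerDl sumr_ge0 // => j _.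
  by rewrite mxE -expr2 sqr_ge0.
have uu0 : 0 <= (u *m u^T) 0 0.
  by rewrite mxE sumr_ge0 // => j _; rewrite mxE -expr2 sqr_ge0.
apply: (@le_trans _ _ ((\sum_i \sum_j `|H eps i j|) * (u *m u^T) 0 0)); last first.
  rewrite ler_wpM2r //; apply: le_trans (ler_norm _) _; near: eps; exact: HC.
rewrite -mulmxA mxE mulr_suml; apply: ler_sum => i _.
rewrite mxE mulr_sumr mulr_suml; apply: ler_sum => j _; rewrite mxE.
apply: le_trans (ler_norm _) _; rewrite !normrM mulrCA ler_wpM2l //.
have [uij|/ltW uji] := leP `|u 0 i| `|u 0 j|.
  by apply: le_trans (u_le j); rewrite expr2 ler_wpM2r.
by apply: le_trans (u_le i); rewrite expr2 ler_wpM2l.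
Unshelve. all: by end_near.
Qed.

(* On the left kernel of the columns of degree [< s], [u *m Vmx e (eps X)] is [O(eps ^ s)]. *)
Lemma Keps_quad_le m s : (s <= k)%N ->
  (forall j : 'I_(NP d k), (mabs (e j) < s)%N -> (j < m)%N) ->
  exists C : R, \forall eps \near (0 : R)^', forall u : 'rV[R]_n, u *m Vmx e X m = 0 ->
    (u *m Keps X K eps *m u^T) 0 0 <= C * `|eps| ^+ (2 * s) * (u *m u^T) 0 0.
Proof.
move=> sk sm; have [W1 [W2 [W3 [W1O W2O W3O KE]]]] := Keps_expand X openO O0 K_smooth e_graded.
(* The monomial matrix at the points [eps x_i] with its columns of degree below [s] set to 0; its
   product with an admissible [u] is unchanged. *)
pose V eps : 'M[R]_(n, NP d k) := \matrix_(i, j)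
  if (mabs (e j) < s)%N then 0 else mono (X i) (e j) * eps ^+ mabs (e j).
have VO : big_O_mx s V.
  move=> i j; have [js|sj] := ltnP (mabs (e j)) s.
    by apply: big_O_eq (big_O0 R s) => eps; rewrite mxE js.
  have := big_OM (big_O_cst (mono (X i) (e j))) (big_O_X R (mabs (e j))).
  by rewrite add0n => /(big_O_le sj); apply: big_O_eq => eps; rewrite mxE ltnNge sj.
have epsO p q (W : R -> 'M[R]_(p, q)) l : big_O_mx 0 W -> (s <= l)%N ->
    big_O_mx s (fun eps => eps ^+ l *: W eps).
  move=> WO sl i j; have := big_OM (big_O_X R l) (WO i j).
  by rewrite addn0 => /(big_O_le sl); apply: big_O_eq => eps; rewrite mxE.
pose H eps := V eps *m Wr k e K *m (V eps)^T + V eps *m (eps ^+ k.+1 *: W1 eps)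
   + (eps ^+ k.+1 *: W2 eps) *m (V eps)^T + eps ^+ (2 * k.+1) *: W3 eps.
have HO : big_O_mx (2 * s) H.
  rewrite mul2n -addnn; have VtO := big_O_mx_tr VO.
  have addO p q (M M' : R -> 'M[R]_(p, q)) l : big_O_mx l M -> big_O_mx l M' ->
      big_O_mx l (fun eps => M eps + M' eps).
    by move=> MO MO' i j; apply: big_O_eq (big_OD (MO i j) (MO' i j)) => eps; rewrite mxE.
  have AO : big_O_mx (s + s) (fun eps => V eps *m Wr k e K *m (V eps)^T).
    apply: big_O_mxM VtO; rewrite -[s]addn0; apply: big_O_mxM VO _ => i j; exact: big_O_cst.
  have BO : big_O_mx (s + s) (fun eps => V eps *m (eps ^+ k.+1 *: W1 eps)).
    by apply: big_O_mxM VO _; apply: epsO => //; exact: leqW.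
  have CO : big_O_mx (s + s) (fun eps => (eps ^+ k.+1 *: W2 eps) *m (V eps)^T).
    by apply: big_O_mxM _ VtO; apply: epsO => //; exact: leqW.
  have DO : big_O_mx (s + s) (fun eps => eps ^+ (2 * k.+1) *: W3 eps).
    move=> i j; have le : (s + s <= 2 * k.+1 + 0)%N by lia.
    apply: big_O_eq (big_O_le le (big_OM (big_O_X R _) (W3O i j))) => eps.
    by rewrite [RHS]mxE.
  exact: addO _ _ _ _ _ (addO _ _ _ _ _ (addO _ _ _ _ _ AO BO) CO) DO.
have [C HC] := quad_form_le HO; exists C; near=> eps => u uV.
have e0 : eps != 0 by near: eps; exact: nbhs_dnbhs_neq.
have uV' : u *m Vmx e (fun i => eps *: X i) (NP d k) = u *m V eps.
  apply/rowP => j; rewrite !mxE.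
  have [/[dup] js /sm jm|sj] := ltnP (mabs (e j)) s.
    transitivity ((u *m Vmx e X m) 0 (Ordinal jm) * eps ^+ mabs (e j)).
      rewrite mxE mulr_suml; apply: eq_bigr => i _; rewrite !mxE mono_scale.
      by rewrite -mulrA [mono _ _ * _]mulrC.
    rewrite uV mxE mul0r big1 // => i _; by rewrite mxE js mulr0.
  by apply: eq_bigr => i _; rewrite !mxE ltnNge sj /= mono_scale mulrC [mono _ _ * _]mulrC mulrC.
have uVt : (Vmx e (fun i => eps *: X i) (NP d k))^T *m u^T = (V eps)^T *m u^T.
  by rewrite -!trmx_mul uV'.
rewrite (_ : u *m Keps X K eps *m u^T = u *m H eps *m u^T).
  by move: u {uV uV' uVt}; near: eps; exact: HC.
rewrite KE // /H !mulmxDr !mulmxDl scalerDr mulmxDr mulmxDl !addrA; congr (_ + _ + _ + _).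
- by rewrite !mulmxA uV' -!mulmxA uVt.
- by rewrite scalemxAr !mulmxA uV'.
- by rewrite scalemxAl -!mulmxA uVt.
Unshelve. all: by end_near.
Qed.

Lemma Keps_eig_le : (n <= NP d k)%N -> exists C delta : R, 0 < delta /\
  forall (eps : R) (s : nat) (i : 'I_n) lam, 0 < eps < delta -> (s <= k)%N ->
    (0 < s -> NP d s.-1 <= i)%N -> psdmx (Keps X K eps) ->
    eigs_noninc (Keps X K eps) lam -> `|lam i| <= C * eps ^+ (2 * s).
Proof.
(* No constraint is imposed for [s = 0], where [NP d s.-1] would read [NP d 0 = 1]. *)
move=> nN; pose m s := if (0 < s)%N then NP d s.-1 else 0%N.
have sm s : (s <= k)%N -> forall j : 'I_(NP d k), (mabs (e j) < s)%N -> (j < m s)%N.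
  case: s => // s sk j; rewrite ltnS (graded_leq e_graded) //; exact: ltnW.
(* One constant for each [s <= k]; the sum of their absolute values serves all groups at once, on
   the intersection of finitely many neighbourhoods. *)
have [C HC] := fin_all_exists (fun s : 'I_k.+1 => Keps_quad_le (ltn_ord s) (@sm s (ltn_ord s))).
have : \forall eps \near (0 : R)^', forall (s : 'I_k.+1) (u : 'rV[R]_n), u *m Vmx e X (m s) = 0 ->
    (u *m Keps X K eps *m u^T) 0 0 <= C s * `|eps| ^+ (2 * s) * (u *m u^T) 0 0.
  exact: filter_forall HC.
move=> /nbhs_ballP[delta /= delta0 Hd]; exists (\sum_s `|C s|), delta; split => //.
move=> eps s i lam /andP[e0 ed] sk si psd Alam.
have /(_ _ _ (Ordinal (sk : (s < k.+1)%N)))/= H := Hd eps.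
have {}H := H _ (lt0r_neq0 e0).
rewrite ger0_norm; last exact: psd_eig_ge0 psd Alam.
apply: (@le_trans _ _ (C (Ordinal (sk : (s < k.+1)%N)) * `|eps| ^+ (2 * s))).
  apply: eig_le (psd.1) Alam _ (H _); first by rewrite /m; case: ltnP => // /si.
  by rewrite -ball_normE /ball_ /= sub0r normrN gtr0_norm.
rewrite gtr0_norm // ler_wpM2r ?(exprn_ge0 _ (ltW e0)) //.
by rewrite (le_trans (ler_norm _)) // (bigD1 (Ordinal (sk : (s < k.+1)%N))) //= lerDl sumr_ge0.
Qed.

End EigenvalueGroups.

Theorem theorem6p1 (R : realType) (d k n : nat) (Omega : set 'rV[R]_d)
  (K : 'rV[R]_d -> 'rV[R]_d -> R) (e : nat -> mi d) (X : 'I_n -> 'rV[R]_d) :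
  open Omega -> Omega 0 ->
  (1 <= k)%N ->
  Cmm k.+1 Omega K ->
  graded_enum k e ->
  (NP d k.-1 < n <= NP d k)%N ->
  (* 1. *)
  (forall H : n = NP d k,
     eps_expand (fun eps : R => \det (Keps X K eps)) (2 * Mkd k d)
       (\det (Wr k e K) * (\det (castmx (H, erefl) (Vmx e X (NP d k)))) ^+ 2))
  /\
  (* 2. *)
  (forall (Q : 'M[R]_n) (Rt : 'M[R]_(n, NP d k.-1)),
     (n < NP d k)%N ->
     Q *m Q^T = 1%:M ->
     (forall (i : 'I_n) (j : 'I_(NP d k.-1)), (j < i)%N -> Rt i j = 0) ->
     Vmx e X (NP d k.-1) = Q *m Rt ->
     let m := NP d k.-1 in
     let l := (NP d k - n)%N in
     let Y : 'M[R]_(n, NP d k) :=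
       \matrix_(i < n, j < NP d k)
         (if (i < m)%N then (i == j :> nat)%:R
          else if (m <= j)%N then (Q^T *m Vmx e X (NP d k)) i j
          else 0) in
     eps_expand (fun eps : R => \det (Keps X K eps)) (2 * (Mkd k d - k * l))
       (\det (Y *m Wr k e K *m Y^T) *
        \det ((Vmx e X m)^T *m Vmx e X m)))
  /\
  (* 3. *)
  (forall (eps0 : R) (lam : R -> 'I_n -> R),
     0 < eps0 ->
     (forall eps, 0 <= eps <= eps0 -> psdmx (Keps X K eps)) ->
     (forall eps, 0 <= eps <= eps0 -> eigs_noninc (Keps X K eps) (lam eps)) ->
     exists C delta : R, 0 < delta /\
       forall (eps : R) (s : nat) (i : 'I_n),
         0 < eps < delta -> eps <= eps0 ->
         (s <= k)%N ->
         (0 < s -> NP d s.-1 <= i)%N ->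
         (s < k -> i < NP d s)%N ->
         `|lam eps i| <= C * eps ^+ (2 * s)).
Proof.
move=> openO O0 k0 K_smooth e_graded nk; have /andP[_ nN] := nk; split; last split.
- by move=> H; subst n; rewrite castmx_id; exact: det_Keps_square K_smooth e_graded _.
- by move=> Q Rt _ QQ Rt0 VQR; exact: (det_Keps_rect openO O0 K_smooth e_graded k0 nk QQ Rt0 VQR).
move=> eps0 lam eps00 psd eig.
have [C [delta [delta0 H]]] := Keps_eig_le X openO O0 K_smooth e_graded nN.
exists C, delta; split => // eps s i ed ee sk si _.
have e0 : 0 <= eps <= eps0 by case/andP: ed => /ltW -> _.
by apply: H => //; [exact: psd|exact: eig].
Qed.
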